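(* Let $N\ge 2$ and let $F_N=F(A)$ be the free group with free basis $A=\{a_1,\dots,a_N\}$. Then there exist a constant $c>0$ and an integer $M\ge 1$ such that for all integers $n\ge M$ we have \[ f_{prim}(n)\ \ge\ f_{simp}(n)\ \ge\ f_{fill}(n)\ \ge\ c\,\frac{\log n}{\log\log n}. \]
   Context: Let $F$ be a free group of finite rank. A nontrivial $g\in F$ is primitive in $F$ if it belongs to some free basis of $F$. It is simple in $F$ if it belongs to a proper free factor of $F$. An element $g\in F$ is non-filling in $F$ if there is a splitting of $F$ as an amalgamated free product $F=K\ast_C L$ or as an HNN-extension $F=\langle K,t\mid t^{-1}Ct=C'\rangle$ such that $C\le F$ is either trivial or a maximal cyclic subgroup of $F$, such that $C\ne K$ and $C\ne L$ in the amalgamated product case, and such that $g\in K$. It is filling if it is not non-filling. For $1\ne g\in F_N$, $d_{prim}(g)$ (respectively $d_{simp}(g)$, $d_{fill}(g)$) is the smallest index $[F_N:H]$ over all finite-index subgroups $H\le F_N$ such that $g\in H$ and $g$ is primitive (respectively simple, non-filling) in $H$; these are finite. For $n\ge 1$, $f_{prim}(n)$ (respectively $f_{simp}(n)$, $f_{fill}(n)$) is the maximum of $d_{prim}(g)$ (respectively $d_{simp}(g)$, $d_{fill}(g)$) over all nontrivial $g\in F_N$ that are not proper powers in $F_N$ and satisfy $|g|_A\le n$, where $|g|_A$ is the freely reduced length of $g$ over $A$. These functions do not depend on the choice of free basis $A$. *)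

(* Defs.v *)
From HB Require Import structures.
From mathcomp Require Import all_boot all_order all_algebra.
From mathcomp Require Import all_classical all_reals all_analysis.

Set Implicit Arguments.
Unset Strict Implicit.
Unset Printing Implicit Defensive.

Local Open Scope classical_set_scope.
Local Open Scope card_scope.
Local Open Scope group_scope.

(* The groups here may be infinite (groupType), and a subgroup of G is a
   predicate H : groupClosed G closed under the group operations.  A
   homomorphism defined on H is a map f : G -> Q that is multiplicative on H;
   its values outside H are irrelevant. *)
Notation hom_on H f := {in H &, {morph f : x y / x * y}}.

Section SubgroupType.
Variables (G : groupType) (H : groupClosed G).

(* H as a group in its own right *)
Definition subgroup := {x : G | x \in H}.

Lemma subgroup_closed : group_closed H.
Proof. by split=> [|x y xH yH]; [exact: gpred1 | apply: gpredM; rewrite ?gpredVr]. Qed.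

HB.instance Definition _ := SubChoice.on subgroup.
HB.instance Definition _ :=
  SubChoice_isSubGroup.Build G (fun x => x \in H) subgroup subgroup_closed.

End SubgroupType.

Section FreeGroups.
Variable G : groupType.

(* X is a free basis of G: every map from X to a group Q extends uniquely to a
   homomorphism from G to Q. *)
Definition free_basis (X : set G) : Prop :=
  forall (Q : groupType) (phi : G -> Q),
    exists f : {multiplicative G -> Q},
      (forall x, X x -> f x = phi x) /\
      (forall f' : {multiplicative G -> Q},
         (forall x, X x -> f' x = phi x) -> f' =1 f).

(* G = K *_C L, by the universal property of the pushout of the inclusions of
   C in K and L *)
Definition amalgamated_product (K L : groupClosed G) (C : {pred G}) : Prop :=
  [/\ {subset C <= K}, {subset C <= L} &
    forall (Q : groupType) (f g : G -> Q),
      hom_on K f -> hom_on L g -> {in C, f =1 g} ->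
      exists h : {multiplicative G -> Q},
        [/\ {in K, h =1 f}, {in L, h =1 g} &
          forall h' : {multiplicative G -> Q},
            {in K, h' =1 f} -> {in L, h' =1 g} -> h' =1 h]].

(* G = < K, t | t^-1 C t = C' >, by the universal property of this relative
   presentation; recall that x ^ t is t^-1 * (x * t). *)
Definition HNN_extension (K C C' : groupClosed G) (t : G) : Prop :=
  [/\ {subset C <= K}, {subset C' <= K},
    (forall x, (x \in C) = (x ^ t \in C')) &
    forall (Q : groupType) (f : G -> Q) (s : Q),
      hom_on K f -> {in C, forall x, f (x ^ t) = f x ^ s} ->
      exists h : {multiplicative G -> Q},
        [/\ {in K, h =1 f}, h t = s &
          forall h' : {multiplicative G -> Q},
            {in K, h' =1 f} -> h' t = s -> h' =1 h]].

Definition trivial_subgroup (C : groupClosed G) : Prop := C =i pred1 1.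

Definition cyclic_subgroup (C : groupClosed G) : Prop :=
  exists z : G, forall x,
    x \in C <-> exists n : nat, x = z ^+ n \/ x = z ^- n.

Definition maximal_cyclic_subgroup (C : groupClosed G) : Prop :=
  cyclic_subgroup C /\
  forall D : groupClosed G,
    cyclic_subgroup D -> {subset C <= D} -> D =i C.

Definition free_factor (K : groupClosed G) : Prop :=
  exists L : groupClosed G, amalgamated_product K L (pred1 1).

Definition primitive (g : G) : Prop :=
  g <> 1 /\ exists2 X : set G, free_basis X & X g.

Definition simple (g : G) : Prop :=
  exists K : groupClosed G, [/\ free_factor K, ~ K =i predT & g \in K].

Definition non_filling (g : G) : Prop :=
  exists K C : groupClosed G,
    [/\ g \in K, trivial_subgroup C \/ maximal_cyclic_subgroup C &
      (exists L : groupClosed G,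
         [/\ amalgamated_product K L C, ~ C =i K & ~ C =i L]) \/
      (exists (C' : groupClosed G) (t : G), HNN_extension K C C' t)].

Definition proper_power (g : G) : Prop :=
  exists (h : G) (k : nat), (1 < k)%N /\ g = h ^+ k.

Definition has_index (H : groupClosed G) (d : nat) : Prop :=
  [set A : set G | exists x, A = [set y | x^-1 * y \in H]] #= `I_d.

End FreeGroups.

(* The smallest index of a finite-index subgroup H containing g such that g has
   property P in H; it is 0 if there is no such H.  (An infinite-index H has no
   index d : nat.) *)
Definition min_index (P : forall H : groupType, H -> Prop)
    (F : groupType) (g : F) : nat :=
  infimum 0%N [set d | exists (H : groupClosed F) (gH : g \in H),
    has_index H d /\ P (subgroup H) (Sub g gH)].

Definition d_prim := min_index primitive.
Definition d_simp := min_index simple.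
Definition d_fill := min_index non_filling.

Section Words.
Variables (N : nat) (F : groupType) (a : 'I_N -> F).

(* (i, true) stands for the letter a_i and (i, false) for its inverse. *)
Definition letter_val (l : 'I_N * bool) : F :=
  if l.2 then a l.1 else (a l.1)^-1.

Definition word_val (w : seq ('I_N * bool)) : F := \prod_(l <- w) letter_val l.

(* no two adjacent letters are mutually inverse *)
Definition reduced (w : seq ('I_N * bool)) : bool :=
  sorted (fun l m => ~~ ((l.1 == m.1) && (l.2 != m.2))) w.

(* |g|_A.  When a enumerates a free basis, the reduced word representing g
   exists and is unique. *)
Definition reduced_length (g : F) : nat :=
  size (xget [::] [set w | reduced w /\ word_val w = g]).

(* The maximum over the (finite) set of admissible g; if the set of values were
   empty or unbounded, this would be 0. *)
Definition max_over_length (d : F -> nat) (n : nat) : nat :=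
  supremum 0%N [set d g | g in
    [set g | [/\ g <> 1, ~ proper_power g & (reduced_length g <= n)%N]]].

Definition f_prim := max_over_length (@d_prim F).
Definition f_simp := max_over_length (@d_simp F).
Definition f_fill := max_over_length (@d_fill F).

End Words.

(* Main.v *)
Require Import Defs.
From HB Require Import structures.
From mathcomp Require Import all_boot all_order all_algebra.
From mathcomp Require Import all_classical all_reals all_analysis.
From mathcomp Require Import all_fingroup zify ring lra.

(** The first two inequalities compare the three notions in one subgroup at a time.  A
    primitive element of a nonabelian group generates a proper free factor, so it is
    simple, and a proper free splitting is a splitting over the trivial group, so a
    simple element is non-filling.  The minimal indices decrease accordingly, provided
    that the smallest set of indices is not empty: every nontrivial g is primitive in
    some subgroup of finite index (primitive_finite_index), obtained by completing a
    circle labelled by g to a finite covering of the rose.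

    For the lower bound one needs, for every d > 0, an element h of length at most (B d)^d
    that is not a proper power and that fills every subgroup H of index at most d
    containing it.  Let tau x be the translation length of x on the Cayley tree of F.
    If x and y do not commute then tau x and tau y are at most tau (x^5 y^5)
    (tau_combine).  As this holds for all pairs, it also holds after any
    embedding psi of a subgroup that contains x and y.  Now combine the (d!)-th powers of
    all elements of length at most 4 d along a balanced binary tree
    (controlling_element).  A power of the result h lies in every subgroup of index at
    most d, the length of h is at most d! times an exponential of d, and h controls all
    short elements u of every such subgroup H that contains h: tau (psi u) is at most
    c * tau (psi h) for every embedding psi of H, where c does not depend on psi.

    Suppose that h lies in a vertex group of a splitting of H over a trivial or maximal
    cyclic group.  Twisting along the splitting gives infinitely many automorphisms of
    H that fix h; they come directly from the universal property of the splitting, so no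
    normal forms are needed.  Since they fix h, all their values on short elements have
    bounded translation length.  Short elements include generators of H and
    their products of two factors, and a Helly argument in the Cayley tree
    (coarse_helly) bounds the lengths of the images of the generators after a
    conjugation.  By the pigeonhole principle two of the twists differ by a conjugation
    (embeddings_conjugate), and the structure of centralizers in a free group excludes
    this (filling).

    Finally (B d)^d <= n holds for d about log n / (2 log log n). *)

Set Implicit Arguments.
Unset Strict Implicit.
Unset Printing Implicit Defensive.

Local Open Scope group_scope.

Section Words.
Variable N : nat.
Notation letter := ('I_N * bool)%type.

(** * Reduced words *)

Definition inv_letter (l : letter) : letter := (l.1, ~~ l.2).

Definition inv_word (w : seq letter) := rev (map inv_letter w).

Definition composable (o1 o2 : option letter) :=
  if o1 is Some l then (if o2 is Some m then m != inv_letter l else true)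
  else true.

Definition olast (w : seq letter) := ohead (rev w).

(** Equivalently, w can be concatenated with itself without cancellation. *)
Definition cyc_reduced (w : seq letter) :=
  reduced w && composable (olast w) (ohead w).

Lemma inv_letterK : involutive inv_letter.
Proof. by case=> i b; rewrite /inv_letter /= negbK. Qed.

Lemma inv_letter_neq l : inv_letter l != l.
Proof. by case: l => i [] //; rewrite /inv_letter /= xpair_eqE eqxx. Qed.

Lemma cancellingE (l m : letter) :
  ((l.1 == m.1) && (l.2 != m.2)) = (m == inv_letter l).
Proof.
by case: l m => [i b] [j c]; rewrite /inv_letter xpair_eqE /= eq_sym; case: b c => [] [].
Qed.

Lemma inv_wordK : involutive inv_word.
Proof.
by move=> w; rewrite /inv_word map_rev revK -map_comp (eq_map inv_letterK) map_id.
Qed.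

Lemma inv_word_cat u w : inv_word (u ++ w) = inv_word w ++ inv_word u.
Proof. by rewrite /inv_word map_cat rev_cat. Qed.

Lemma size_inv_word w : size (inv_word w) = size w.
Proof. by rewrite size_rev size_map. Qed.

Lemma inv_word_rcons w l : inv_word (rcons w l) = inv_letter l :: inv_word w.
Proof. by rewrite /inv_word map_rcons rev_rcons. Qed.

Lemma inv_word_cons l w : inv_word (l :: w) = rcons (inv_word w) (inv_letter l).
Proof. by rewrite /inv_word /= rev_cons. Qed.

Lemma olast_rcons w l : olast (rcons w l) = Some l.
Proof. by rewrite /olast rev_rcons. Qed.

Lemma olast_cat u w : olast (u ++ w) = if w is [::] then olast u else olast w.
Proof.
case/lastP: w => [|w l]; first by rewrite cats0.
by rewrite -rcons_cat !olast_rcons; case: w.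
Qed.

Lemma olast_inv w : olast (inv_word w) = omap inv_letter (ohead w).
Proof. by case: w => [|l w] //; rewrite inv_word_cons olast_rcons. Qed.

Lemma ohead_inv w : ohead (inv_word w) = omap inv_letter (olast w).
Proof. by case/lastP: w => [|w l] //; rewrite inv_word_rcons olast_rcons. Qed.

Lemma composable_sym o1 o2 :
  composable (omap inv_letter o2) (omap inv_letter o1) = composable o1 o2.
Proof.
by case: o1 o2 => [l|] [m|] //=; rewrite inv_letterK eq_sym.
Qed.

Lemma reduced_cat (u w : seq letter) :
  reduced (u ++ w) = [&& reduced u, reduced w & composable (olast u) (ohead w)].
Proof.
case/lastP: u => [|u l]; first by rewrite /= andbT.
case: w => [|m w]; first by rewrite cats0 olast_rcons /= andbT.
rewrite olast_rcons /= -cancellingE /reduced.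
case: u => [|k u] /=; first by rewrite andbC.
by rewrite cat_path /= last_rcons; case: (path _ _ _); case: (path _ _ _); rewrite ?andbT ?andbF.
Qed.

Lemma reduced_inv w : reduced (inv_word w) = reduced w.
Proof.
elim: w => [|l w IHw] //; rewrite inv_word_cons -cats1 -[l :: w]cat1s !reduced_cat IHw.
by rewrite olast_inv (_ : ohead [:: inv_letter l] = omap inv_letter (olast [:: l])) // composable_sym.
Qed.

Lemma cyc_reduced_inv w : cyc_reduced (inv_word w) = cyc_reduced w.
Proof.
by rewrite /cyc_reduced reduced_inv olast_inv ohead_inv composable_sym.
Qed.

Lemma cancellation (s u : seq letter) : reduced s -> reduced u ->
  exists p t q : seq letter, [/\ s = p ++ t, u = inv_word t ++ q & reduced (p ++ q)].
Proof.
elim/last_ind: s u => [|s l IHs] u rs ru; first by exists [::], [::], u.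
case: u ru => [|m u] ru; first by exists (rcons s l), [::], [::]; rewrite cats0.
have [e|ne] := eqVneq m (inv_letter l); last first.
  exists (rcons s l), [::], (m :: u); rewrite cats0; split=> //.
  by rewrite reduced_cat rs ru olast_rcons.
have rs' : reduced s by move: rs; rewrite -cats1 reduced_cat => /and3P[].
have ru' : reduced u by move: ru; rewrite -cat1s reduced_cat => /and3P[].
have [p [t [q [-> -> r]]]] := IHs u rs' ru'.
by exists p, (rcons t l), q; rewrite inv_word_rcons e rcons_cat.
Qed.

End Words.
Arguments inv_letter {N}.
Arguments inv_word {N}.
Arguments composable {N}.
Arguments olast {N}.
Arguments cyc_reduced {N}.

(** * Permutations tracing a word *)

(** A new pair is added by composing with one transposition; it moves no value
    already prescribed, because the second components are distinct. *)
Lemma perm_extension (T : finType) (s : seq (T * T)) :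
  uniq (unzip1 s) -> uniq (unzip2 s) ->
  exists p : {perm T}, forall xy, xy \in s -> p xy.1 = xy.2.
Proof.
elim: s => [|[x y] s IHs] /=; first by exists 1.
case/andP=> xs us1 /andP[ys us2]; have [p pP] := IHs us1 us2.
exists (p * tperm (p x) y) => -[x' y']; rewrite inE => /orP[/eqP[-> ->]|xys] /=.
  by rewrite permM tpermL.
rewrite permM (pP _ xys) /= tpermD //.
- rewrite -[y'](pP _ xys) /=; apply: contraNneq xs => /perm_inj ->.
  by apply/mapP; exists (x', y').
- by apply: contraNneq ys => ->; apply/mapP; exists (x', y').
Qed.

Lemma source_inj N (T : finType) (w : seq ('I_N * bool)) (v : nat -> T) :
  (forall k k', k < size w -> k' < size w -> v k = v k' -> k = k')%N ->
  (forall k k', k < size w -> k' < size w -> v k.+1 = v k'.+1 -> k = k')%N ->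
  (forall l0 k k', k < size w -> k' < size w -> v k = v k'.+1 ->
     nth l0 w k != inv_letter (nth l0 w k'))%N ->
  forall l0 k k', (k < size w)%N -> (k' < size w)%N ->
    let s k := (if (nth l0 w k).2 then v k else v k.+1, (nth l0 w k).1) in
    s k = s k' -> k = k'.
Proof.
move=> v1 v2 v3 l0 k k' kw k'w /= [e1 e2].
move: (v3 l0 k k' kw k'w) (v3 l0 k' k k'w kw) e1; rewrite -!cancellingE e2 eqxx /=.
case: (nth l0 w k).2; case: (nth l0 w k').2 => //= c1 c2 e;
by [apply: v1|apply: v2|have := c1 e|have := c2 (esym e)].
Qed.

(** The three hypotheses say that each generator is read along w as an injective partial
    map: no two of its edges share a source or a target.  In the folding of labelled
    graphs this is the condition that there is nothing to fold. *)
Lemma letter_perms N (T : finType) (w : seq ('I_N * bool)) (v : nat -> T) :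
  (forall k k', k < size w -> k' < size w -> v k = v k' -> k = k')%N ->
  (forall k k', k < size w -> k' < size w -> v k.+1 = v k'.+1 -> k = k')%N ->
  (forall l0 k k', k < size w -> k' < size w -> v k = v k'.+1 ->
     nth l0 w k != inv_letter (nth l0 w k'))%N ->
  exists p : 'I_N -> {perm T}, forall l0 k, (k < size w)%N ->
    let l := nth l0 w k in
    if l.2 then p l.1 (v k) = v k.+1 else p l.1 (v k.+1) = v k.
Proof.
move=> v1 v2 v3.
case: w v1 v2 v3 => [|l1 w']; first by exists (fun=> 1).
set w := l1 :: w' => v1 v2 v3.
pose ed k := let l := nth l1 w k in if l.2 then (v k, v k.+1) else (v k.+1, v k).
pose es i := [seq ed k | k <- iota 0 (size w) & (nth l1 w k).1 == i].
have H i : exists p : {perm T}, forall xy, xy \in es i -> p xy.1 = xy.2.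
  apply: perm_extension; rewrite /es /unzip1 /unzip2 -map_comp map_inj_in_uniq ?filter_uniq ?iota_uniq //;
  move=> k k'; rewrite !mem_filter !mem_iota !add0n /= => /andP[/eqP ki kw] /andP[/eqP k'i k'w];
  rewrite /ed /=; move: (v3 l1 k k' kw k'w) (v3 l1 k' k k'w kw);
  rewrite -!cancellingE ki k'i eqxx /=;
  case: (nth l1 w k).2; case: (nth l1 w k').2 => //= c1 c2 e;
  by [apply: v1|apply: v2|have := c1 e|have := c2 (esym e)|have := c1 (esym e)|have := c2 e].
have [p pP] := choice H.
exists p => l0 k kw; rewrite (set_nth_default l1) //=.
have : ed k \in es (nth l1 w k).1.
  by apply: map_f; rewrite mem_filter mem_iota eqxx.
move=> /pP.
by rewrite /ed; case: (nth l1 w k).2.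
Qed.

(** * Homomorphisms *)
Section HomOn.
Variables (G Q : groupType) (H : groupClosed G) (f : G -> Q).
Hypothesis fM : hom_on H f.

Lemma hom_on1 : f 1 = 1.
Proof. by apply: (mulgI (f 1)); rewrite -fM ?gpred1 // !mulg1. Qed.

Lemma hom_onV : {in H, {morph f : x / x^-1}}.
Proof.
by move=> x xH; apply: (mulgI (f x)); rewrite -fM ?gpredV // !mulgV hom_on1.
Qed.

Lemma hom_onX n : {in H, {morph f : x / x ^+ n}}.
Proof.
move=> x xH; elim: n => [|n IHn]; first by rewrite !expg0 hom_on1.
by rewrite !expgS fM ?gpredXn // IHn.
Qed.
End HomOn.

Section Hom.
Variables (G Q : groupType) (f : {multiplicative G -> Q}).

Lemma hom1 : f 1 = 1.
Proof. by apply: (mulgI (f 1)); rewrite -gmulfM !mulg1. Qed.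

Lemma homV : {morph f : x / x^-1}.
Proof. by move=> x; apply: (mulgI (f x)); rewrite -gmulfM !mulgV hom1. Qed.

Lemma homX n : {morph f : x / x ^+ n}.
Proof.
by move=> x; elim: n => [|n IHn]; rewrite ?expg0 ?hom1 // !expgS gmulfM IHn.
Qed.

Lemma homJ : {morph f : x y / x ^ y}.
Proof. by move=> x y; rewrite !conjgE !gmulfM homV. Qed.
End Hom.

(** * Powers and common roots *)
Definition power_of (G : groupType) (w x : G) := exists n : nat, x = w ^+ n \/ x = w ^- n.

Lemma power_ofV (G : groupType) (w x : G) : power_of w x -> power_of w x^-1.
Proof. by move=> [n [->|->]]; exists n; [right|left; rewrite invgK]. Qed.

Lemma power_of_mulX (G : groupType) (w : G) m n : power_of w (w ^+ m * w ^- n).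
Proof.
have [mn|/ltnW nm] := leqP m n.
  exists (n - m)%N; right; rewrite expgnFr // invgF; congr (_ * _).
  exists (m - n)%N; left; by rewrite expgnFr.
Qed.

Lemma power_ofM (G : groupType) (w x y : G) :
  power_of w x -> power_of w y -> power_of w (x * y).
Proof.
move=> [m [->|->]] [n [->|->]].
- by exists (m + n)%N; left; rewrite expgnDr.
- exact: power_of_mulX.
- have -> : w ^- m * w ^+ n = w ^+ n * w ^- m.
    by apply: commuteX; apply: commute_sym; apply: commuteV; apply: commuteX.
  exact: power_of_mulX.
- by exists (n + m)%N; right; rewrite expgnDr invgM.
Qed.

Lemma power_of1 (G : groupType) (w : G) : power_of w 1.
Proof. by exists 0%N; left. Qed.

Lemma power_of_refl (G : groupType) (w : G) : power_of w w.
Proof. by exists 1%N; left. Qed.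

Lemma power_ofJ (G : groupType) (w x u : G) : power_of w x -> power_of (w ^ u) (x ^ u).
Proof. by move=> [n [->|->]]; exists n; [left|right]; rewrite ?conjVg conjXg. Qed.

Lemma power_of_commute (G : groupType) (w x z : G) : power_of w x -> commute w z -> commute x z.
Proof.
move=> [n [->|->]] wz; apply: commute_sym; first exact/commuteX/commute_sym.
exact/commuteV/commuteX/commute_sym.
Qed.

(** Membership of w in the subgroup generated by x and y, quantified over arbitrary
    predicates: this form can be transported along conjugation and restricted to
    a subgroup type. *)
Definition generated_by (G : groupType) (x y w : G) :=
  forall P : G -> Prop, P 1 -> (forall u v, P u -> P v -> P (u * v)) ->
    (forall u, P u -> P u^-1) -> P x -> P y -> P w.

Definition common_root (G : groupType) (x y : G) := exists w,
  [/\ power_of w x, power_of w y & generated_by x y w].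

Lemma common_root_sym (G : groupType) (x y : G) : common_root x y -> common_root y x.
Proof.
by move=> [w [h1 h2 h3]]; exists w; split=> // P p1 pM pV px py; apply: h3.
Qed.

Lemma common_rootV (G : groupType) (x y : G) : common_root x y^-1 -> common_root x y.
Proof.
move=> [w [h1 h2 h3]]; exists w; split=> //.
  by rewrite -[y]invgK; apply: power_ofV.
by move=> P p1 pM pV px py; apply: h3 => //; apply: pV.
Qed.

Lemma common_rootJ (G : groupType) (x y v : G) : common_root (x ^ v) (y ^ v) -> common_root x y.
Proof.
move=> [w [h1 h2 h3]]; exists (w ^ v^-1); split.
- by rewrite -[x](conjgK v); apply: power_ofJ.
- by rewrite -[y](conjgK v); apply: power_ofJ.
move=> P p1 pM pV px py; apply: (h3 (fun z => P (z ^ v^-1))).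
- by rewrite conj1g.
- by move=> u u' pu pu'; rewrite conjMg; apply: pM.
- by move=> u pu; rewrite conjVg; apply: pV.
- by rewrite conjgK.
- by rewrite conjgK.
Qed.

Lemma common_rootM (G : groupType) (x y : G) : common_root x (x^-1 * y) -> common_root x y.
Proof.
move=> [w [h1 h2 h3]]; exists w; split=> //.
  by rewrite -[y](mulVKg x); apply: power_ofM.
by move=> P p1 pM pV px py; apply: h3 => //; apply: pM => //; apply: pV.
Qed.

(** * Permutational wreath products *)
Section Wreath.
Variables (Q : groupType) (T : finType).

(** A homomorphism to this group is an action on T together with a label in Q for every
    edge of the action, multiplied along paths. *)
Definition wreath : Type := {ffun T -> Q} * {perm T}.

HB.instance Definition _ := Choice.on wreath.

Definition wreath_one : wreath := ([ffun=> 1], 1).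
Definition wreath_mul (x y : wreath) : wreath :=
  ([ffun i => x.1 i * y.1 (x.2 i)], x.2 * y.2).
Definition wreath_inv (x : wreath) : wreath :=
  ([ffun i => (x.1 (x.2^-1 i))^-1], x.2^-1).

Lemma wreath_mulA : associative wreath_mul.
Proof.
move=> x y z; congr pair; last by rewrite /= mulgA.
by apply/ffunP => i; rewrite !ffunE /= ?ffunE permM mulgA.
Qed.

Lemma wreath_mul1 : left_id wreath_one wreath_mul.
Proof.
case=> f s; congr pair; last by rewrite /= mul1g.
by apply/ffunP => i; rewrite !ffunE /= perm1 mul1g.
Qed.

Lemma wreath_mulr1 : right_id wreath_one wreath_mul.
Proof.
case=> f s; congr pair; last by rewrite /= mulg1.
by apply/ffunP => i; rewrite !ffunE /= mulg1.
Qed.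

Lemma wreath_mulV : left_inverse wreath_one wreath_inv wreath_mul.
Proof.
case=> f s; congr pair; last by rewrite /= mulVg.
by apply/ffunP => i; rewrite !ffunE /= mulVg.
Qed.

Lemma wreath_mulrV : right_inverse wreath_one wreath_inv wreath_mul.
Proof.
case=> f s; congr pair; last by rewrite /= mulgV.
by apply/ffunP => i; rewrite !ffunE /= permK mulgV.
Qed.

HB.instance Definition _ := isGroup.Build wreath wreath_mulA wreath_mul1 wreath_mulr1
  wreath_mulV wreath_mulrV.

End Wreath.

(** * Subgroups given by propositions *)

Section PropSubgroup.
Variables (G : groupType) (P : G -> Prop).
Hypothesis P1 : P 1.
Hypothesis PM : forall x y, P x -> P y -> P (x * y).
Hypothesis PV : forall x, P x -> P x^-1.

Lemma prop_subgroup : exists H : groupClosed G, forall x, x \in H <-> P x.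
Proof.
pose S : {pred G} := fun x => `[< P x >].
have SE x : x \in S <-> P x by rewrite unfold_in; split=> /asboolP.
have S1 : 1 \in S by apply/SE.
have SM : {in S &, forall u v, u * v \in S}.
  by move=> x y /SE Px /SE Py; apply/SE/PM.
have SV : {in S, forall u, u^-1 \in S} by move=> x /SE Px; apply/SE/PV.
pose H1 := isMulClosed.Build G S SM.
pose H2 := isMul1Closed.Build G S S1.
pose H3 := isInvClosed.Build G S SV.
pose H : groupClosed G := HB.pack S H1 H2 H3.
by exists H.
Qed.
End PropSubgroup.

(** * Normal forms in a free group *)

Section FreeGroup.
Variables (N : nat) (F : groupType) (a : 'I_N -> F).
Hypotheses (a_inj : injective a) (a_basis : free_basis (range a)).
Notation letter := ('I_N * bool)%type.
Notation val_w := (word_val a).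

Lemma hom_ext (Q : groupType) (p : 'I_N -> Q) :
  exists f : {multiplicative F -> Q}, forall i, f (a i) = p i.
Proof.
pose phi x := if [pick i | a i == x] is Some i then p i else 1.
have [f [fP _]] := a_basis phi; exists f => i.
rewrite fP /phi; last by exists i.
by case: pickP => [j /eqP/a_inj-> //|/(_ i)]; rewrite eqxx.
Qed.

Lemma word_val_cat u w : val_w (u ++ w) = val_w u * val_w w.
Proof. by rewrite /word_val big_cat. Qed.

Lemma word_val_cons l w : val_w (l :: w) = letter_val a l * val_w w.
Proof. by rewrite /word_val big_cons. Qed.

Lemma word_val_nil : val_w [::] = 1.
Proof. by rewrite /word_val big_nil. Qed.

Lemma word_val1 l : val_w [:: l] = letter_val a l.
Proof. by rewrite word_val_cons word_val_nil mulg1. Qed.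

Lemma word_val_rcons w l : val_w (rcons w l) = val_w w * letter_val a l.
Proof. by rewrite -cats1 word_val_cat word_val1. Qed.

Lemma letter_val_inv l : letter_val a (inv_letter l) = (letter_val a l)^-1.
Proof. by case: l => i []; rewrite /letter_val //= invgK. Qed.

Lemma word_val_inv w : val_w (inv_word w) = (val_w w)^-1.
Proof.
elim: w => [|l w IHw]; first by rewrite (_ : inv_word [::] = [::]) // word_val_nil invg1.
by rewrite inv_word_cons word_val_rcons word_val_cons invgM IHw letter_val_inv.
Qed.

(** Let P be the subgroup of all values of words.  The map from F to P given by the
    universal property, followed by the inclusion, fixes the basis; so it is the
    identity of F. *)
Lemma word_val_surj g : exists w, val_w w = g.
Proof.
have [|||P PE] := @prop_subgroup F (fun x => exists w, val_w w = x).
- by exists [::]; rewrite word_val_nil.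
- by move=> x y [u <-] [w <-]; exists (u ++ w); rewrite word_val_cat.
- by move=> x [w <-]; exists (inv_word w); rewrite word_val_inv.
have aP i : a i \in P by apply/PE; exists [:: (i, true)]; rewrite word_val1.
have [r rP] := hom_ext (fun i => (Sub (a i) (aP i) : subgroup P)).
have [e [eP eU]] := a_basis (fun x : F => x).
pose f1 : {multiplicative F -> F} := idfun.
pose f2 : {multiplicative F -> F} := (val : subgroup P -> F) \o r.
have e1 := eU f1 (fun x _ => erefl).
have e2 : f2 =1 e.
  by apply: eU => x [i _ <-]; rewrite /f2 /= rP SubK.
have -> : g = val (r g) by rewrite [RHS](e2 g) -e1.
by apply/PE; exact: valP (r g).
Qed.

Lemma reduce_word w :
  exists r, [/\ reduced r, val_w r = val_w w & (size r <= size w)%N].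
Proof.
elim: w => [|l w [r [rr rw rs]]]; first by exists [::].
have [p [t [q [e1 e2 e3]]]] := cancellation (isT : reduced [:: l]) rr.
exists (p ++ q); split=> //.
  by rewrite word_val_cons -rw -word_val1 e1 e2 !word_val_cat word_val_inv mulgA mulgK.
move: (congr1 size e1) (congr1 size e2) rs; rewrite !size_cat size_inv_word /=; lia.
Qed.

Lemma path_action (T : finType) (w : seq letter) (v : nat -> T) :
  (forall k k', k < size w -> k' < size w -> v k = v k' -> k = k')%N ->
  (forall k k', k < size w -> k' < size w -> v k.+1 = v k'.+1 -> k = k')%N ->
  (forall l0 k k', k < size w -> k' < size w -> v k = v k'.+1 ->
     nth l0 w k != inv_letter (nth l0 w k'))%N ->
  exists f : {multiplicative F -> {perm T}}, forall l0 k, (k < size w)%N ->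
    f (letter_val a (nth l0 w k)) (v k) = v k.+1.
Proof.
move=> v1 v2 v3; have [p pP] := letter_perms v1 v2 v3.
have [f fP] := hom_ext p; exists f => l0 k kn; have := pP l0 k kn; cbv zeta.
by case: (nth _ _ _) => i [] /=; rewrite /letter_val /= ?homV fP // => <-; rewrite permK.
Qed.

Lemma path_trace (T : finType) (f : {multiplicative F -> {perm T}}) w v :
  (forall l0 k, (k < size w)%N -> f (letter_val a (nth l0 w k)) (v k) = v k.+1) ->
  forall k, (k <= size w)%N -> f (val_w (take k w)) (v 0%N) = v k.
Proof.
move=> fP; elim=> [|k IHk] kn; first by rewrite take0 word_val_nil hom1 perm1.
have [l0 _] : exists l0 : letter, True by case: w kn {fP IHk} => // l0; exists l0.
by rewrite (take_nth l0) // word_val_rcons gmulfM permM IHk 1?ltnW // fP.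
Qed.

(** The word w labels a path with distinct vertices 0, ..., n.  Completing the path
    to an action of F on these vertices gives a permutation representation in which
    w moves 0 to n. *)
Lemma reduced_neq1 w : reduced w -> val_w w = 1 -> w = [::].
Proof.
move=> rw w1; apply/eqP; rewrite -size_eq0; apply/negPn/negP => w0.
pose n := size w; pose v k : 'I_n.+1 := inord k.
have vI k k' : (k <= n)%N -> (k' <= n)%N -> v k = v k' -> k = k'.
  by move=> kn k'n /(congr1 val); rewrite /= !inordK.
have [|||f fP] := @path_action _ w v.
- by move=> k k' kn k'n; apply: vI; rewrite ltnW.
- by move=> k k' kn k'n /vI-/(_ kn k'n) [].
- move=> l0 k k' kn k'n e.
  have {e}ek : k = k'.+1 by apply: vI e => //; rewrite ltnW.
  move: rw; rewrite -{1}(cat_take_drop k w) reduced_cat => /and3P[_ _].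
  by rewrite (drop_nth l0) // ek (take_nth l0) // olast_rcons.
have := path_trace fP (leqnn n); rewrite take_size w1 hom1 perm1 => /vI.
by move=> /(_ (leq0n _) (leqnn _)) e; rewrite -/n -e in w0.
Qed.

Lemma word_val_inj u w : reduced u -> reduced w -> val_w u = val_w w -> u = w.
Proof.
elim: u w => [|l u IHu] w ru rw e.
  by rewrite (reduced_neq1 rw) // -e word_val_nil.
case: w rw e => [|m w] rw e; first by rewrite (reduced_neq1 ru) // e word_val_nil.
have [elm|lm] := eqVneq l m.
  rewrite elm (IHu w) //.
  - by move: ru; rewrite -cat1s reduced_cat => /and3P[].
  - by move: rw; rewrite -cat1s reduced_cat => /and3P[].
  - by move: e; rewrite !word_val_cons elm => /mulgI.
have r : reduced (inv_word (l :: u) ++ m :: w).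
  rewrite reduced_cat reduced_inv ru rw olast_inv /= inv_letterK.
  by rewrite eq_sym.
have := reduced_neq1 r; rewrite word_val_cat word_val_inv e mulVg.
by move=> /(_ erefl) /(congr1 size); rewrite size_cat size_inv_word.
Qed.

Definition nf (g : F) : seq letter := xget [::] [set w | reduced w /\ word_val a w = g]%classic.

Lemma nfP g : reduced (nf g) /\ val_w (nf g) = g.
Proof.
have [w <-] := word_val_surj g; have [r [rr rw _]] := reduce_word w.
by rewrite /nf; case: xgetP => [x -> //|/(_ r) []].
Qed.

Lemma nf_reduced g : reduced (nf g). Proof. exact: (nfP g).1. Qed.
Lemma nfK g : val_w (nf g) = g. Proof. exact: (nfP g).2. Qed.
Lemma nf_word w : reduced w -> nf (val_w w) = w.
Proof. by move=> rw; apply: word_val_inj; rewrite ?nf_reduced ?nfK. Qed.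

Lemma nf_inj : injective nf.
Proof. exact: can_inj nfK. Qed.

Lemma nf1 : nf 1 = [::].
Proof. by rewrite -word_val_nil nf_word. Qed.

Lemma nfV g : nf g^-1 = inv_word (nf g).
Proof. by rewrite -{1}[g]nfK -word_val_inv nf_word // reduced_inv nf_reduced. Qed.

Definition len g := reduced_length a g.

Lemma lenE g : len g = size (nf g). Proof. by []. Qed.

Lemma len_word w : (len (val_w w) <= size w)%N.
Proof. by have [r [rr <- s]] := reduce_word w; rewrite lenE nf_word. Qed.

Lemma len1 : len 1 = 0%N. Proof. by rewrite lenE nf1. Qed.

Lemma len_eq0 g : len g = 0%N -> g = 1.
Proof. by move/size0nil => e; rewrite -[g]nfK [nf g]e word_val_nil. Qed.

Lemma lenV g : len g^-1 = len g.
Proof. by rewrite !lenE nfV size_inv_word. Qed.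

Lemma lenM x y : (len (x * y) <= len x + len y)%N.
Proof. by rewrite -{1}[x]nfK -{1}[y]nfK -word_val_cat (leq_trans (len_word _)) // size_cat. Qed.

Lemma nfM x y : exists p t q : seq letter,
  [/\ nf x = p ++ t, nf y = inv_word t ++ q & nf (x * y) = p ++ q].
Proof.
have [p [t [q [e1 e2 r]]]] := cancellation (nf_reduced x) (nf_reduced y).
exists p, t, q; split=> //; rewrite -[x in LHS]nfK -[y in LHS]nfK e1 e2.
rewrite -[RHS]nf_word // !word_val_cat word_val_inv; congr nf; by rewrite mulgA mulgK.
Qed.

Definition nocancel x y := composable (olast (nf x)) (ohead (nf y)).

Lemma nfM_nocancel x y : nocancel x y -> nf (x * y) = nf x ++ nf y.
Proof.
move=> xy; rewrite -[RHS]nf_word ?word_val_cat ?nfK //.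
by rewrite reduced_cat !nf_reduced.
Qed.

Definition cyc g := cyc_reduced (nf g).

Lemma cycE g : cyc g = nocancel g g.
Proof. by rewrite /cyc /cyc_reduced nf_reduced. Qed.

(** * Lengths of conjugates and powers *)

Lemma len_conj_letter x l : (len (x ^ letter_val a l) <= len x + 2)%N.
Proof.
have e1 : (len (letter_val a l) <= 1)%N by rewrite -word_val1 len_word.
rewrite conjgE; apply: leq_trans (lenM _ _) _; rewrite lenV.
by apply: leq_trans (leq_add (leqnn _) (lenM _ _)) _; lia.
Qed.

Lemma nf_cons x l w : nf x = l :: w -> x = letter_val a l * word_val a w.
Proof. by rewrite -word_val_cons => <-; rewrite nfK. Qed.

Lemma nf_rcons x l w : nf x = rcons w l -> x = word_val a w * letter_val a l.
Proof. by rewrite -word_val_rcons => <-; rewrite nfK. Qed.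

Lemma conj_head x l : ohead (nf x) = Some l -> (len (x ^ letter_val a l) <= len x)%N.
Proof.
case E : (nf x) => [|m w] //= [ml]; rewrite ml in E.
have -> : len x = (size w).+1 by rewrite lenE E.
rewrite (nf_cons E) conjgE !mulgA mulVg mul1g -word_val_rcons.
by rewrite (leq_trans (len_word _)) // size_rcons.
Qed.

Lemma conj_last x l : olast (nf x) = Some (inv_letter l) ->
  (len (x ^ letter_val a l) <= len x)%N.
Proof.
case/lastP E : (nf x) => [|w m] //; rewrite olast_rcons => -[ml]; rewrite ml in E.
have -> : len x = (size w).+1 by rewrite lenE E size_rcons.
rewrite (nf_rcons E) conjgE letter_val_inv mulgVK.
by rewrite -letter_val_inv -word_val_cons (leq_trans (len_word _)).
Qed.

Lemma ends_split x l :
  ohead (nf x) = Some l -> olast (nf x) = Some (inv_letter l) ->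
  exists w, nf x = l :: rcons w (inv_letter l) /\
    x = letter_val a l * word_val a w * (letter_val a l)^-1.
Proof.
case E : (nf x) => [|m w] //= [ml]; rewrite ml in E *.
case/lastP: w E => [|w k] E.
  by case=> lE; have := inv_letter_neq l; rewrite -lE eqxx.
rewrite -rcons_cons olast_rcons => -[kl]; rewrite kl in E *.
exists w; split=> //; rewrite -letter_val_inv.
by rewrite (nf_cons E) word_val_rcons mulgA.
Qed.

Lemma conj_ends x l :
  ohead (nf x) = Some l -> olast (nf x) = Some (inv_letter l) ->
  (len (x ^ letter_val a l) + 2 <= len x)%N.
Proof.
move=> fx lx; have [w [E xE]] := ends_split fx lx.
have -> : len x = (size w).+2 by rewrite lenE E /= size_rcons.
rewrite xE conjgE !mulgA mulVg mul1g mulgVK addn2 !ltnS.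
exact: len_word.
Qed.

Lemma not_cycP x : ~~ cyc x ->
  exists l, ohead (nf x) = Some l /\ olast (nf x) = Some (inv_letter l).
Proof.
rewrite cycE /nocancel /composable; case: olast => [m|] //.
case: ohead => [l|] //; rewrite negbK => /eqP lm; exists l; split=> //.
by rewrite lm inv_letterK.
Qed.

(** Peel off the cancelling end letters one pair at a time. *)
Lemma cyclic_reduction x : exists (s : seq letter) c,
  [/\ cyc c, nf x = s ++ nf c ++ inv_word s & x = word_val a s * c * (word_val a s)^-1].
Proof.
have [n] := ubnP (len x); elim: n x => // n IHn x; rewrite ltnS => xn.
have [cx|/not_cycP[l [fx lx]]] := boolP (cyc x).
  by exists [::], x; rewrite cats0 word_val_nil invg1 mulg1 mul1g.
have [w [E xE]] := ends_split fx lx.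
have rw : reduced w.
  have := nf_reduced x; rewrite E -cat1s -cats1 !reduced_cat.
  by case/and3P=> _ /and3P[].
have [|s [c [cc e1 e2]]] := IHn (word_val a w).
  by move: xn; rewrite !lenE nf_word // E /= size_rcons; lia.
exists (l :: s), c; split=> //.
  by rewrite E inv_word_cons -(nf_word rw) e1 -!cats1 /= -!catA.
by rewrite {1}xE e2 word_val_cons invgM !mulgA.
Qed.

Definition wpow (w : seq letter) k := iter k (cat w) [::].

Arguments wpow : simpl never.

Lemma wpowS w k : wpow w k.+1 = w ++ wpow w k.
Proof. by []. Qed.

Lemma size_wpow w k : size (wpow w k) = (k * size w)%N.
Proof. by elim: k => // k IHk; rewrite wpowS size_cat IHk mulSn. Qed.

Lemma wpowSr w k : wpow w k.+1 = wpow w k ++ w.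
Proof. by elim: k => [|k IHk]; rewrite wpowS ?cats0 // {1}IHk catA -wpowS. Qed.

Lemma ohead_cat_neq0 (u w : seq letter) : u <> [::] -> ohead (u ++ w) = ohead u.
Proof. by case: u. Qed.

Lemma olast_cat_neq0 (u w : seq letter) : w <> [::] -> olast (u ++ w) = olast w.
Proof. by rewrite olast_cat; case: w. Qed.

Lemma wpow_neq0 w k : w <> [::] -> wpow w k.+1 <> [::].
Proof. by case: w. Qed.

Lemma ohead_wpow w k : ohead (wpow w k.+1) = ohead w.
Proof. by case: w => // ; elim: k. Qed.

Lemma olast_wpow w k : olast (wpow w k.+1) = olast w.
Proof. by rewrite wpowSr olast_cat; case: w => //; elim: k. Qed.

Lemma nf_neq0 c : c <> 1 -> nf c <> [::].
Proof. by move=> c1 e; apply: c1; rewrite -[c]nfK e word_val_nil. Qed.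

Lemma nf_cycX c k : cyc c -> nf (c ^+ k) = wpow (nf c) k.
Proof.
rewrite cycE => cc; elim: k => [|k IHk]; first by rewrite expg0 nf1.
rewrite expgS nfM_nocancel ?IHk // /nocancel IHk.
case: k {IHk} => [|k]; first by rewrite /wpow /=; case: olast.
by rewrite ohead_wpow.
Qed.

Lemma lenX_cyc c k : cyc c -> len (c ^+ k) = (k * len c)%N.
Proof. by move=> cc; rewrite !lenE nf_cycX // size_wpow. Qed.

Lemma nfX x s c k : cyc c -> nf x = s ++ nf c ++ inv_word s ->
  x = word_val a s * c * (word_val a s)^-1 -> c <> 1 ->
  nf (x ^+ k.+1) = s ++ wpow (nf c) k.+1 ++ inv_word s.
Proof.
move=> cc E xE c1; have cn0 := nf_neq0 c1.
have rx := nf_reduced x; rewrite E in rx.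
have -> : x ^+ k.+1 = word_val a s * c ^+ k.+1 * (word_val a s)^-1.
  by have := conjXg c (word_val a s)^-1 k.+1; rewrite !conjgE invgK !mulgA -xE => <-.
have rW : reduced (wpow (nf c) k.+1) by rewrite -nf_cycX // nf_reduced.
have [oW hW] := (olast_wpow (nf c) k, ohead_wpow (nf c) k).
have Wn0 := @wpow_neq0 (nf c) k cn0.
rewrite -word_val_inv -[c ^+ _]nfK -!word_val_cat nf_cycX // -catA nf_word //.
move: (wpow _ _) rW oW hW Wn0 => W rW oW hW Wn0.
move: rx; rewrite !reduced_cat !ohead_cat_neq0 // rW oW hW.
by case/and3P=> -> /and3P[_ -> ->] ->.
Qed.

Lemma ends_expS x k :
  ohead (nf (x ^+ k.+1)) = ohead (nf x) /\ olast (nf (x ^+ k.+1)) = olast (nf x).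
Proof.
have [s [c [cc E xE]]] := cyclic_reduction x.
have [c1|/eqP c1] := eqVneq c 1.
  by rewrite xE c1 mulg1 mulgV expg1n.
rewrite (nfX _ cc E xE c1) E; have cn0 := nf_neq0 c1; have wn0 := wpow_neq0 (k := k) cn0.
case: s {E xE} => [|l s]; first by rewrite !cats0 ohead_wpow olast_wpow.
split=> //; rewrite !catA !(@olast_cat_neq0 _ (inv_word _)) //;
by move=> /(congr1 size); rewrite size_inv_word.
Qed.

Lemma len_gt0 x : x <> 1 -> (0 < len x)%N.
Proof. by move=> x1; rewrite lt0n; apply/eqP => /len_eq0. Qed.

Lemma len_expS x k : x <> 1 -> (len x + k <= len (x ^+ k.+1))%N.
Proof.
move=> x1; have [s [c [cc E xE]]] := cyclic_reduction x.
have c1 : c <> 1 by move=> c1; apply: x1; rewrite xE c1 mulg1 mulgV.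
have := len_gt0 c1.
rewrite !lenE (nfX _ cc E xE c1) E !size_cat size_wpow size_inv_word.
move: (size (nf c)) (size s) => m n; nia.
Qed.

(** * Translation length *)
Lemma tau_ex x : exists n, `[< exists v, len (x ^ v) = n >].
Proof. by exists (len (x ^ 1)); apply/asboolP; exists 1. Qed.

(** The translation length of x on the Cayley tree of F. *)
Definition tau x := ex_minn (tau_ex x).

(* The operations of F are reached through several chains of structure inclusions,
   so lia may see convertible lengths as distinct atoms; this makes them equal. *)
Ltac unify_args f :=
  repeat match goal with |- context [f ?x] =>
    match goal with |- context [f ?y] =>
      tryif constr_eq x y then fail else
        (unify x y; replace (f y) with (f x) by reflexivity)
    end
  end.
Ltac glia := unify_args len; unify_args tau; lia.

Lemma tau_le x v : (tau x <= len (x ^ v))%N.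
Proof. by rewrite /tau; case: ex_minnP => n _; apply; apply/asboolP; exists v. Qed.

Lemma tau_le1 x : (tau x <= len x)%N.
Proof. by rewrite -{2}[x]conjg1 tau_le. Qed.

Lemma tau_attained x : exists v, len (x ^ v) = tau x.
Proof. by rewrite /tau; case: ex_minnP => n /asboolP. Qed.

Lemma tauJ x v : tau (x ^ v) = tau x.
Proof.
apply/eqP; rewrite eqn_leq; apply/andP; split.
  by have [u <-] := tau_attained x; rewrite -[x in len (x ^ u)](conjgK v) -conjgM tau_le.
by have [u <-] := tau_attained (x ^ v); rewrite -conjgM tau_le.
Qed.

Lemma len_conj_ge x v : (len x <= len (x ^ v) + 2 * len v)%N.
Proof.
rewrite -{1}[x](conjgK v) conjgE; apply: leq_trans (lenM _ _) _; rewrite invgK.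
by apply: leq_trans (leq_add (leqnn _) (lenM _ _)) _; rewrite lenV; lia.
Qed.

Lemma lenX_le x k : (len (x ^+ k) <= k * len x)%N.
Proof.
elim: k => [|k IHk]; first by rewrite expg0 len1.
by rewrite expgS mulSn (leq_trans (lenM _ _)) // leq_add2l.
Qed.

(** Conjugation changes the length of every power of c by at most the same constant,
    while the length of the powers of c grows by len c at each step. *)
Lemma tau_cyc c : cyc c -> tau c = len c.
Proof.
move=> cc; apply/eqP; rewrite eqn_leq tau_le1 /=.
have [v <-] := tau_attained c; rewrite leqNgt; apply/negP => lt.
pose k := (2 * len v).+1.
have := leq_trans (len_conj_ge (c ^+ k) v).
rewrite conjXg lenX_cyc // => /(_ _ (leq_add (lenX_le _ _) (leqnn _))).
apply/negP; rewrite -ltnNge /k; move: lt; move: (len (c ^ v)) (len v) (len c) => p q r; nia.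
Qed.

Lemma tauX x k : tau (x ^+ k) = (k * tau x)%N.
Proof.
have [s [c [cc _ ->]]] := cyclic_reduction x.
have e : word_val a s * c * (word_val a s)^-1 = c ^ (word_val a s)^-1.
  by rewrite conjgE invgK mulgA.
rewrite e -conjXg !tauJ tau_cyc ?lenX_cyc ?tau_cyc //.
case: k => [|k]; first by rewrite expg0 /cyc nf1.
by rewrite /cyc /cyc_reduced nf_reduced (ends_expS _ _).1 (ends_expS _ _).2; case/andP: cc.
Qed.

Lemma tauV x : tau x^-1 = tau x.
Proof.
have H y : (tau y^-1 <= tau y)%N.
  by have [v <-] := tau_attained y; rewrite -lenV -conjVg tau_le.
by apply/eqP; rewrite eqn_leq H /= -{1}[x]invgK H.
Qed.

Lemma cyc_tau x : len x = tau x -> cyc x.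
Proof.
move=> e; apply/negPn/negP => /not_cycP[l [h1 h2]].
have := conj_ends h1 h2; have := tau_le x (letter_val a l); lia.
Qed.

Lemma tau_gt0 x : x <> 1 -> (0 < tau x)%N.
Proof.
move=> x1; have [v <-] := tau_attained x; apply: len_gt0 => e.
by apply: x1; rewrite -[x](conjgK v) e conj1g.
Qed.

Lemma tau1 : tau 1 = 0%N.
Proof. by apply/eqP; rewrite -leqn0 -len1 tau_le1. Qed.

Lemma torsion_free (x : F) k : x ^+ k.+1 = 1 -> x = 1.
Proof.
move=> e; apply: contrapT => x1; have := tau_gt0 x1.
by have := tauX x k.+1; rewrite e tau1; lia.
Qed.

Lemma nonpower_root g : g <> 1 ->
  exists h k, [/\ ~ proper_power h, g = h ^+ k.+1 & (len h <= len g)%N].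
Proof.
have [n] := ubnP (len g); elim: n g => // n IHn g; rewrite ltnS => gn g1.
have [[h [k [k1 gE]]]|np] := pselect (proper_power g); last by exists g, 0%N.
have h1 : h <> 1 by move=> h1; apply: g1; rewrite gE h1 expg1n.
have lg : (len h < len g)%N.
  by case: k k1 gE => // k k1 ->; have := len_expS k h1; lia.
have [|h' [k' [np hE lh]]] := IHn h _ h1; first exact: leq_trans lg gn.
exists h', (k'.+1 * k).-1; split=> //; last by lia.
by rewrite prednK ?muln_gt0; [rewrite gE hE expgnA|lia].
Qed.

(** * Pairs of elements in normal position *)

(** Take a conjugate of the pair with the smallest total length.  If two letters
    cancel in x y or y x and x or y is not cyclically reduced, conjugating by the
    cancelling letter would shorten that element by 2 without lengthening the
    other one. *)
Lemma pair_normal x y : exists v,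
  (len (x ^ v) + len (y ^ v) <= len x + len y)%N /\
  ((nocancel (x ^ v) (y ^ v) /\ nocancel (y ^ v) (x ^ v)) \/
   (cyc (x ^ v) /\ cyc (y ^ v))).
Proof.
pose P n := `[< exists v, len (x ^ v) + len (y ^ v) = n >]%N.
have exP : exists n, P n by exists (len (x ^ 1) + len (y ^ 1))%N; apply/asboolP; exists 1.
case: (ex_minnP exP) => n /asboolP[v vn] nmin; exists v.
have {}nmin u : (n <= len ((x ^ v) ^ u) + len ((y ^ v) ^ u))%N.
  by rewrite -!conjgM; apply: nmin; apply/asboolP; exists (v * u).
split.
  by rewrite vn; have := nmin v^-1; rewrite !conjgK.
clear P exP; move: (x ^ v) (y ^ v) vn nmin => {}x {}y vn nmin.
have H x' y' : (len x' + len y' = n)%N ->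
    (forall u, n <= len (x' ^ u) + len (y' ^ u))%N ->
    ~~ nocancel x' y' -> cyc x' /\ cyc y'.
  move=> {}vn {}nmin; rewrite {1}/nocancel /composable.
  case lx : olast => [m|] //; case fy : ohead => [k|] //.
  rewrite negbK => /eqP km; split; apply/negPn/negP => /not_cycP[l [h1 h2]].
    have fy' : ohead (nf y') = Some l.
      by rewrite fy km; move: h2; rewrite lx => -[->]; rewrite inv_letterK.
    have := conj_ends h1 h2; have := conj_head fy'; have := nmin (letter_val a l).
    by move: vn; lia.
  have lx' : olast (nf x') = Some (inv_letter l).
    by rewrite lx; move: h1; rewrite fy km => -[<-]; rewrite inv_letterK.
  have := conj_ends h1 h2; have := conj_last lx'; have := nmin (letter_val a l).
  by move: vn; lia.
have [xy|/(H x y vn nmin)] := boolP (nocancel x y); last by right.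
have [yx|] := boolP (nocancel y x); first by left.
have vn' : (len y + len x = n)%N by rewrite addnC.
by move/(H y x vn') => [|]; [move=> u; rewrite addnC|right].
Qed.

(** * Commuting elements *)

(** Euclid's algorithm.  In normal position, after inverting y if necessary, nothing
    cancels in x y and y x; then x y = y x is an equality of words, so the shorter
    element is a prefix of the longer one and can be divided out. *)
Lemma commute_common_root (x y : F) : commute x y -> common_root x y.
Proof.
have [n] := ubnP (len x + len y)%N; elim: n x y => // n IHn x y; rewrite ltnS => xyn cxy.
have [->|/eqP x1] := eqVneq x 1.
  exists y; split; [exact: power_of1|exact: power_of_refl|by []].
have [->|/eqP y1] := eqVneq y 1.
  exists x; split; [exact: power_of_refl|exact: power_of1|by []].
have NC x' y' : x' <> 1 -> y' <> 1 -> commute x' y' -> (len x' + len y' <= n)%N ->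
    nocancel x' y' -> nocancel y' x' -> common_root x' y'.
  wlog le : x' y' / (len x' <= len y')%N => [W|] x'1 y'1 c' n' h1 h2.
    have [le|/ltnW le] := leqP (len x') (len y'); first exact: W.
    by apply/common_root_sym/W => //; rewrite addnC.
  have e : nf x' ++ nf y' = nf y' ++ nf x' by rewrite -!nfM_nocancel // c'.
  have y'E : nf y' = nf x' ++ drop (size (nf x')) (nf y').
    rewrite -{1}(cat_take_drop (size (nf x')) (nf y')); congr (_ ++ _).
    have := congr1 (take (size (nf x'))) e.
    by rewrite take_size_cat // takel_cat // => ->.
  apply: common_rootM; apply: IHn; last first.
    by apply: commuteM => //; apply: commuteV.
  have -> : x'^-1 * y' = word_val a (drop (size (nf x')) (nf y')).
    by rewrite -{1}[y']nfK y'E word_val_cat nfK mulKg -y'E.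
  have := len_word (drop (size (nf x')) (nf y')); rewrite size_drop -!lenE.
  have := len_gt0 x'1; lia.
have [v [lev NP]] := pair_normal x y.
apply: (@common_rootJ _ _ _ v).
have cv : commute (x ^ v) (y ^ v) by rewrite /commute -!conjMg cxy.
have {lev xyn}lev := leq_trans lev xyn.
have xv1 : x ^ v <> 1 by move/eqP; rewrite conjg_eq1 => /eqP.
have yv1 : y ^ v <> 1 by move/eqP; rewrite conjg_eq1 => /eqP.
clear x1 y1 cxy; move: (x ^ v) (y ^ v) cv lev xv1 yv1 NP => x' y' cv lev x1 y1 [[h1 h2]|[cx cy]].
  exact: NC.
have NC' x2 y2 : x2 <> 1 -> y2 <> 1 -> commute x2 y2 -> (len x2 + len y2 <= n)%N ->
    cyc x2 -> cyc y2 -> ~~ nocancel x2 y2 -> common_root x2 y2.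
  move=> x21 y21 c2 n2 cx2 cy2; rewrite {1}/nocancel /composable.
  case lx : olast => [m|] //; case fy : ohead => [k|] //; rewrite negbK => /eqP km.
  rewrite km in fy; move: cx2 cy2; rewrite !cycE /nocancel lx fy => cx2 cy2.
  apply: common_rootV; apply: NC => //.
  - by move/eqP; rewrite invg_eq1 => /eqP.
  - exact: commuteV.
  - by rewrite lenV.
  - rewrite /nocancel nfV ohead_inv lx; move: cy2; case: olast => //= k'.
    by rewrite eq_sym.
  - by rewrite /nocancel nfV olast_inv fy /= inv_letterK.
have [h1|h1] := boolP (nocancel x' y'); last exact: NC'.
have [h2|h2] := boolP (nocancel y' x'); first exact: NC.
by apply: common_root_sym; apply: NC' => //; rewrite addnC.
Qed.

Lemma expg_cyc x k : cyc (x ^+ k.+1) -> cyc x.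
Proof.
by rewrite /cyc /cyc_reduced !nf_reduced (ends_expS _ _).1 (ends_expS _ _).2.
Qed.

(** After a conjugation that makes x cyclically reduced, x and y have powers with equal
    normal forms; then y is cyclically reduced too, and both are prefixes of the same
    word, of the same length. *)
Lemma unique_root (x y : F) k : x ^+ k.+1 = y ^+ k.+1 -> x = y.
Proof.
have [s [c [cc _ xE]]] := cyclic_reduction x.
have -> : x = c ^ (word_val a s)^-1 by rewrite xE conjgE invgK mulgA.
rewrite -conjXg => e; apply: (conjg_inj (word_val a s)); rewrite conjgKV.
have {}e : c ^+ k.+1 = (y ^ word_val a s) ^+ k.+1 by rewrite -conjXg -e conjgKV.
move: (y ^ _) e => {}y e.
have cy : cyc y.
  apply: (@expg_cyc _ k); rewrite -e /cyc /cyc_reduced nf_reduced.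
  by rewrite (ends_expS _ _).1 (ends_expS _ _).2; case/andP: cc.
have e2 := congr1 nf e; rewrite !nf_cycX // in e2.
have sz : size (nf c) = size (nf y).
  by move: (congr1 size e2); rewrite !size_wpow => /eqP; rewrite eqn_pmul2l // => /eqP.
apply: nf_inj; have := congr1 (take (size (nf c))) e2.
by rewrite wpowS take_size_cat // wpowS sz take_size_cat.
Qed.

Lemma commute_root (x y : F) k : commute (x ^+ k.+1) y -> commute x y.
Proof.
move=> c; have : x ^ y = x.
  by apply: (@unique_root _ _ k); rewrite -conjXg conjgE c mulKg.
by move=> e; rewrite /commute conjgC e.
Qed.

Lemma power_of_root (w x y : F) : x <> 1 -> power_of w x -> commute x y -> commute w y.
Proof.
move=> x1 [[|n] [xE|xE]] c; rewrite xE ?expg0 ?invg1 in x1 c *; try by case: x1.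
  exact: commute_root c.
apply: (@commute_root _ _ n); rewrite -[w ^+ _]invgK; apply: commute_sym.
exact/commuteV/commute_sym.
Qed.

(** Commutation is transitive away from 1 since centralizers are cyclic. *)
Lemma commute_trans (x y z : F) : x <> 1 -> commute x y -> commute x z -> commute y z.
Proof.
move=> x1 /commute_common_root[w [wx wy _]] xz.
exact: power_of_commute wy (power_of_root x1 wx xz).
Qed.

(** Both elements are powers of one element and have the same translation length, so
    v ^ t is v or v^-1.  In the second case t^2 commutes with v, hence so does t. *)
Lemma commute_conj (v t : F) : commute v (v ^ t) -> commute v t.
Proof.
have [-> _|/eqP v1] := eqVneq v 1; first exact/commute_sym/commute1.
move=> c; have [w [wv wvt _]] := commute_common_root c.
have w1 : w <> 1 by move=> w1; case: wv v1 => n [->|->]; rewrite w1 expg1n ?invg1.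
have [e|e] : v ^ t = v \/ v ^ t = v^-1.
  have tw := tau_gt0 w1.
  case: wv => n vE; case: wvt => m vtE.
  have tv : tau v = (n * tau w)%N by case: vE => ->; rewrite ?tauV tauX.
  have : tau (v ^ t) = (m * tau w)%N by case: vtE => ->; rewrite ?tauV tauX.
  rewrite tauJ tv => /eqP; rewrite eqn_pmul2r // => /eqP nm; rewrite -nm in vtE.
  by case: vE vtE => vE [] ->; rewrite vE ?invgK; [left|right|right|left].
  by rewrite /commute conjgC e.
have t1 : t <> 1.
  move=> t1; apply: v1; move: e; rewrite t1 conjg1 => e.
  by apply: (@torsion_free _ 1); rewrite expg2 {1}e mulVg.
have t2 : t ^+ 2 <> 1 by move/torsion_free.
apply/commute_sym/(commute_trans t2); first exact/commute_sym/commuteX/commute_refl.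
have e2 : v ^ (t ^+ 2) = v by rewrite expg2 conjgM e conjVg e invgK.
by apply: commute_sym; rewrite /commute conjgC e2.
Qed.

Lemma common_power (x y : F) : x <> 1 -> y <> 1 -> commute x y ->
  exists i j, y ^+ i.+1 = x ^+ j.+1 \/ y ^+ i.+1 = x ^- j.+1.
Proof.
move=> x1 y1 /commute_common_root[w [[m wx] [n wy] _]].
have m0 : m <> 0%N by move=> m0; apply: x1; case: wx => ->; rewrite m0 expg0 ?invg1.
have n0 : n <> 0%N by move=> n0; apply: y1; case: wy => ->; rewrite n0 expg0 ?invg1.
case: m m0 wx => // m _ wx; case: n n0 wy => // n _ wy; exists m, n.
by case: wx => ->; case: wy => ->; rewrite ?expVgn ?invgK expgnAC; [left|right|right|left].
Qed.

(** * Combining two elements *)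
Definition prefix_of (t w : seq letter) := exists q, w = t ++ q.

Lemma take_prefix_of n t w : prefix_of t w -> (n <= size t)%N -> take n w = take n t.
Proof. by move=> [q ->] nt; rewrite takel_cat. Qed.

(** The theorem of Fine and Wilf on words with two periods: the first |u| + |w| letters
    of t can be read both as u ++ w and as w ++ u. *)
Lemma periods_commute t u w k j :
  prefix_of t (wpow u k) -> prefix_of t (wpow w j) ->
  (size u + size w <= size t)%N -> u ++ w = w ++ u.
Proof.
have H u' w' k' j' : prefix_of t (wpow u' k') -> prefix_of t (wpow w' j') ->
    (size u' + size w' <= size t)%N -> u' ++ w' = take (size u' + size w') t.
  move=> p1 p2 st; have le1 : (size t <= k' * size u')%N.
    by have [q e] := p1; rewrite -size_wpow e size_cat leq_addr.
  have le2 : (size t <= j' * size w')%N.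
    by have [q e] := p2; rewrite -size_wpow e size_cat leq_addr.
  rewrite -(take_prefix_of p1) //.
  case: k' p1 le1 => [|k'] p1 le1.
    have -> : u' = [::] by apply: size0nil; lia.
    by have -> : w' = [::] by apply: size0nil; lia.
  rewrite wpowS takeD take_size_cat // drop_size_cat //; congr (_ ++ _).
  have <- : take (size w') (wpow u' k'.+1) = take (size w') (wpow u' k').
    by rewrite wpowSr takel_cat // size_wpow; move: le1 st; rewrite mulSn; lia.
  rewrite (take_prefix_of p1) -?(take_prefix_of p2); try lia.
  case: j' p2 le2 => [|j'] p2 le2; last by rewrite wpowS take_size_cat.
  by have -> : w' = [::] by apply: size0nil; lia.
by move=> p1 p2 st; rewrite (H _ _ _ _ p1 p2) // addnC (H _ _ _ _ p2 p1) // addnC.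
Qed.

(** A longer cancellation would be a common prefix of powers of x^-1 and of y, and
    these two periodic words would force x^-1 and y to commute. *)
Lemma cancellation_bound x y k j p t q : cyc x -> cyc y -> ~ commute x y ->
  nf (x ^+ k) = p ++ t -> nf (y ^+ j) = inv_word t ++ q ->
  (size t < len x + len y)%N.
Proof.
move=> cx cy nc e1 e2; rewrite ltnNge; apply/negP => st; apply: nc.
have : inv_word (nf x) ++ nf y = nf y ++ inv_word (nf x).
  apply: (@periods_commute (inv_word t) _ _ k j).
  - exists (inv_word p); rewrite -inv_word_cat -e1 -!nfV -expVgn nf_cycX //.
    by rewrite /cyc nfV cyc_reduced_inv.
  - by exists q; rewrite -e2 nf_cycX.
  - by rewrite !size_inv_word.
move=> /(congr1 (word_val a)); rewrite !word_val_cat word_val_inv !nfK => e.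
by rewrite -[x]invgK; apply/commute_sym/commuteV.
Qed.

(** Rotating x and y simultaneously along the letters that cancel in y x moves this
    cancellation to the junction x y.  The end of the process is the conjugate
    for which x^M y^M is shortest, where M is so large that neither power is absorbed. *)
Lemma one_junction x y : cyc x -> cyc y -> ~ commute x y ->
  exists v, [/\ cyc (x ^ v), cyc (y ^ v) & nocancel (y ^ v) (x ^ v)].
Proof.
move=> cx cy nc; pose M := (tau x + tau y)%N.+1.
pose P n := `[< exists v, [/\ cyc (x ^ v), cyc (y ^ v) &
  len ((x ^+ M * y ^+ M) ^ v) = n] >].
have exP : exists n, P n.
  by exists (len ((x ^+ M * y ^+ M) ^ 1)); apply/asboolP; exists 1; rewrite !conjg1.
case: (ex_minnP exP) => n /asboolP[v [cxv cyv vn]] nmin; exists v; split=> //.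
rewrite /nocancel /composable; case ly : olast => [k|] //; case fx : ohead => [l|] //.
apply/negP => /eqP lk; have {}ly : olast (nf (y ^ v)) = Some (inv_letter l).
  by rewrite ly lk inv_letterK.
have cx' : cyc ((x ^ v) ^ letter_val a l).
  apply: cyc_tau; apply/eqP; rewrite eqn_leq tau_le1 andbT.
  by rewrite tauJ (tau_cyc cxv) conj_head.
have cy' : cyc ((y ^ v) ^ letter_val a l).
  apply: cyc_tau; apply/eqP; rewrite eqn_leq tau_le1 andbT.
  by rewrite tauJ (tau_cyc cyv) conj_last.
have /nmin : P (len ((x ^+ M * y ^+ M) ^ (v * letter_val a l))).
  by apply/asboolP; exists (v * letter_val a l); rewrite !conjgM.
rewrite conjgM -vn => le.
have [p [t [q [e1 e2 e3]]]] := nfM ((x ^ v) ^+ M) ((y ^ v) ^+ M).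
have nc' : ~ commute (x ^ v) (y ^ v).
  by rewrite /commute -!conjMg => /conjg_inj.
have := cancellation_bound cxv cyv nc' e1 e2.
rewrite -!tau_cyc // !tauJ => st.
have x1 : x <> 1 by move=> x1; apply: nc; rewrite x1; apply/commute_sym/commute1.
have y1 : y <> 1 by move=> y1; apply: nc; rewrite y1; apply/commute1.
have sX : (M <= len ((x ^ v) ^+ M))%N.
  by rewrite lenX_cyc // -tau_cyc // tauJ leq_pmulr // tau_gt0.
have sY : (M <= len ((y ^ v) ^+ M))%N.
  by rewrite lenX_cyc // -tau_cyc // tauJ leq_pmulr // tau_gt0.
have p0 : p <> [::].
  by move=> p0; move: sX; rewrite lenE e1 p0 /=; move: st; rewrite /M; lia.
have q0 : q <> [::].
  by move=> q0; move: sY; rewrite lenE e2 q0 cats0 size_inv_word; move: st; rewrite /M; lia.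
move: le; rewrite conjMg !conjXg leqNgt => /negP; apply.
have h1 : ohead (nf ((x ^ v) ^+ M * (y ^ v) ^+ M)) = Some l.
  by rewrite e3 ohead_cat_neq0 // -(@ohead_cat_neq0 _ t) // -e1 (ends_expS _ _).1.
have h2 : olast (nf ((x ^ v) ^+ M * (y ^ v) ^+ M)) = Some (inv_letter l).
  by rewrite e3 olast_cat_neq0 // -(@olast_cat_neq0 (inv_word t)) // -e2 (ends_expS _ _).2.
by apply: (leq_trans _ (conj_ends h1 h2)); rewrite addn2 leqnSn.
Qed.

Lemma reduced_self_inv (w : seq letter) : reduced w -> inv_word w = w -> w = [::].
Proof.
move=> rw e; apply: reduced_neq1 => //; apply: (@torsion_free _ 1).
by rewrite expg2 -{1}e word_val_inv mulVg.
Qed.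

(** Comparing the two halves, al and be would both be their own inverses, and a
    free group has no involution. *)
Lemma rotation_not_inv (al be : seq letter) : reduced (al ++ be) -> be ++ al = inv_word (al ++ be) ->
  al ++ be = [::].
Proof.
rewrite inv_word_cat => r e; have [/esym eb /esym ea] : be = inv_word be /\ al = inv_word al.
  have := congr1 (take (size be)) e; rewrite take_size_cat // take_size_cat ?size_inv_word //.
  by move=> eb; split=> //; move: e; rewrite {1}eb => /(congr1 (drop (size (inv_word be)))); rewrite !drop_size_cat.
move: r; rewrite reduced_cat => /and3P[ra rb _].
by rewrite (reduced_self_inv ra ea) (reduced_self_inv rb eb).
Qed.

Lemma take_drop_wpow w j k : (j <= k * size w)%N ->
  exists al be, w = al ++ be /\ take (size w) (drop j (wpow w k.+1)) = be ++ al.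
Proof.
elim: k j => [|k IHk] j jk.
  by exists [::], w; have -> : j = 0%N by [lia]; rewrite drop0 wpowS take_size_cat // cats0.
have [lt|ge] := ltnP j (size w).
  exists (take j w), (drop j w); rewrite cat_take_drop; split=> //.
  rewrite wpowS drop_cat lt take_cat size_drop.
  rewrite ltnNge leq_subr /= subKn 1?ltnW // wpowS takel_cat // ltnW //.
rewrite wpowS drop_cat ltnNge ge /=; apply: IHk; move: jk; rewrite mulSn; lia.
Qed.

(** The case where y is so much longer than x that x^5 cancels completely: the product
    is a suffix q of the periodic word y^5, still longer than 3 |y|.  If q were
    conjugate to something shorter than y, its cyclic reduction would remove more
    than |y| letters at both ends.  As q ends with y it would begin with y^-1, but it
    begins with a rotation of y. *)
Lemma tau_absorbed x y q : cyc y -> y <> 1 -> (4 * len x < len y)%N -> cyc x ->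
  nf (y ^+ 5) = inv_word (nf (x ^+ 5)) ++ q -> (len y <= tau (x ^+ 5 * y ^+ 5))%N.
Proof.
move=> cy y1 xy cx e; have zE : x ^+ 5 * y ^+ 5 = word_val a q.
  by rewrite -[y ^+ 5]nfK e word_val_cat word_val_inv nfK mulVKg.
have rq : reduced q.
  by have := nf_reduced (y ^+ 5); rewrite e reduced_cat => /and3P[].
rewrite zE; have [s [c [cc]]] := cyclic_reduction (word_val a q).
rewrite nf_word // => qE qE'.
have -> : tau (word_val a q) = len c.
  by rewrite qE' -tau_cyc // -[in RHS](tauJ _ (word_val a s)^-1) conjgE invgK mulgA.
rewrite leqNgt; apply/negP => cy'.
have szq : size q = (5 * len y - 5 * len x)%N.
  have := congr1 size e; rewrite -!lenE size_cat size_inv_word -!lenE !lenX_cyc //.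
  by move=> ->; lia.
have szs : (len y < size s)%N.
  have := congr1 size qE; rewrite szq !size_cat size_inv_word -lenE; lia.
have dq : q = drop (5 * len x) (wpow (nf y) 5).
  by rewrite -nf_cycX // e drop_size_cat // size_inv_word -lenE lenX_cyc.
(* q ends with y, and s is longer than y *)
have es : inv_word s = take (size s - len y) (inv_word s) ++ nf y.
  rewrite -{1}(cat_take_drop (size s - len y) (inv_word s)); congr (_ ++ _).
  have : drop (size q - len y) q = nf y.
    rewrite dq size_drop drop_drop size_wpow wpowSr drop_size_cat //.
    by rewrite size_wpow -!lenE; move: szq; lia.
  rewrite {2}qE catA drop_cat.
  have -> : size q = (size (s ++ nf c) + size s)%N by rewrite qE !size_cat size_inv_word; lia.
  rewrite ifF; last by apply/negbTE; rewrite -leqNgt; move: szs; lia.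
  by move=> <-; congr drop; move: szs; lia.
have eq : take (len y) q = inv_word (nf y).
  rewrite qE -[s]inv_wordK es inv_word_cat -catA take_size_cat //.
  by rewrite size_inv_word.
have [|al [be [e1 e2]]] := @take_drop_wpow (nf y) (5 * len x) 4.
  by rewrite -lenE; lia.
have ry := nf_reduced y.
rewrite -dq -lenE eq e1 in e2; rewrite e1 in ry.
by have := rotation_not_inv ry (esym e2); rewrite -e1; exact: nf_neq0.
Qed.

Lemma tau_combine_cyc x y : cyc x -> cyc y -> nocancel y x -> ~ commute x y ->
  (tau x <= tau (x ^+ 5 * y ^+ 5))%N /\ (tau y <= tau (x ^+ 5 * y ^+ 5))%N.
Proof.
move=> cx cy yx nc.
have x1 : x <> 1 by move=> x1; apply: nc; rewrite x1; apply/commute_sym/commute1.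
have y1 : y <> 1 by move=> y1; apply: nc; rewrite y1; apply/commute1.
have [p [t [q [e1 e2 e3]]]] := nfM (x ^+ 5) (y ^+ 5).
have st := cancellation_bound cx cy nc e1 e2.
have s1 : (5 * len x = size p + size t)%N by rewrite -lenX_cyc // lenE e1 size_cat.
have s2 : (5 * len y = size t + size q)%N by rewrite -lenX_cyc // lenE e2 size_cat size_inv_word.
rewrite [tau x]tau_cyc // [tau y]tau_cyc //.
have [p0|/eqP p0] := eqVneq p [::].
  rewrite p0 /= in e1 s1; rewrite -e1 in e2.
  have := @tau_absorbed x y q cy y1 _ cx e2 => H.
  have {}H := H ltac:(lia); split=> //; apply: leq_trans H; lia.
have [q0|/eqP q0] := eqVneq q [::].
  rewrite q0 ?cats0 /= in e2 s2.
  have cV z : cyc z -> cyc z^-1 by rewrite /cyc nfV cyc_reduced_inv.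
  have e4 : nf (x^-1 ^+ 5) = inv_word (nf (y^-1 ^+ 5)) ++ inv_word p.
    by rewrite !expVgn !nfV inv_wordK e2 e1 inv_word_cat.
  have y1' : x^-1 <> 1 by move/eqP; rewrite invg_eq1 => /eqP.
  have := @tau_absorbed y^-1 x^-1 _ (cV _ cx) y1' _ (cV _ cy) e4.
  rewrite !lenV !expVgn -invgM tauV => H.
  have {}H := H ltac:(lia); split=> //; apply: leq_trans H; lia.
have cz : cyc (x ^+ 5 * y ^+ 5).
  rewrite cycE /nocancel e3 olast_cat_neq0 // ohead_cat_neq0 //.
  rewrite -(@olast_cat_neq0 (inv_word t) q) // -e2 -(@ohead_cat_neq0 p t) // -e1.
  by rewrite (ends_expS _ _).1 (ends_expS _ _).2.
have -> : tau (x ^+ 5 * y ^+ 5) = (size p + size q)%N.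
  by rewrite tau_cyc // lenE e3 size_cat.
lia.
Qed.

(** The key inequality.  In normal position either no letters cancel around the product,
    or both elements are cyclically reduced and the cancellation, less than |x| + |y|,
    is small compared with x^5 and y^5, unless one of these powers is absorbed by the
    other.  The exponent 5 leaves enough room in every case. *)
Lemma tau_combine (x y : F) : ~ commute x y ->
  (tau x <= tau (x ^+ 5 * y ^+ 5))%N /\ (tau y <= tau (x ^+ 5 * y ^+ 5))%N.
Proof.
move=> nc; have [v [_ NP]] := pair_normal x y.
have C u (x1 y1 : F) : (tau (x1 ^ u) <= tau ((x1 ^ u) ^+ 5 * (y1 ^ u) ^+ 5))%N /\
    (tau (y1 ^ u) <= tau ((x1 ^ u) ^+ 5 * (y1 ^ u) ^+ 5))%N ->
    (tau x1 <= tau (x1 ^+ 5 * y1 ^+ 5))%N /\ (tau y1 <= tau (x1 ^+ 5 * y1 ^+ 5))%N.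
  by rewrite -!conjXg -conjMg !tauJ.
have ncJ u : ~ commute (x ^ u) (y ^ u) by rewrite /commute -!conjMg => /conjg_inj.
apply: (C v); move: (x ^ v) (y ^ v) (ncJ v) NP.
move=> {nc ncJ}x' y' nc [[xy yx]|[cx cy]]; last first.
  have [u [cx' cy' yx]] := one_junction cx cy nc.
  apply: (C u); apply: tau_combine_cyc => //.
  by rewrite /commute -!conjMg => /conjg_inj.
have x1 : x' <> 1 by move=> x1; apply: nc; rewrite x1; apply/commute_sym/commute1.
have y1 : y' <> 1 by move=> y1; apply: nc; rewrite y1; apply/commute1.
have e : nf (x' ^+ 5 * y' ^+ 5) = nf (x' ^+ 5) ++ nf (y' ^+ 5).
  by apply: nfM_nocancel; rewrite /nocancel (ends_expS _ _).1 (ends_expS _ _).2.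
have X0 z : z <> 1 -> nf (z ^+ 5) <> [::] by move=> z1; apply: nf_neq0 => /torsion_free.
have cz : cyc (x' ^+ 5 * y' ^+ 5).
  rewrite cycE /nocancel e olast_cat_neq0 ?ohead_cat_neq0; try exact: X0.
  by rewrite (ends_expS _ _).1 (ends_expS _ _).2.
rewrite (tau_cyc cz) lenE e size_cat -!lenE.
have := len_expS 4 x1; have := len_expS 4 y1; have := tau_le1 x'; have := tau_le1 y'.
glia.
Qed.

(** * A coarse Helly theorem *)

(** An element of s longer than B has the form l w l^-1 for some letter l.  Two
    different letters are impossible, since the product of the two elements would be
    cyclically reduced of length larger than B; so conjugating by l shortens all the
    long elements, and the short ones keep length at most B + 2. *)
Lemma coarse_helly (s : seq F) B :
  (forall x, x \in s -> (tau x <= B)%N) ->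
  (forall x y, x \in s -> y \in s -> (tau (x * y) <= B)%N) ->
  exists v, forall x, x \in s -> (len (x ^ v) <= B + 2)%N.
Proof.
move=> h1 h2; have [D hD] : exists D, forall x, x \in s -> (len x <= B + 2 + D)%N.
  exists (\sum_(x <- s) len x)%N => x xs.
  have : (len x <= \sum_(x <- s) len x)%N by rewrite (big_rem x) //= leq_addr.
  by lia.
move: D hD => D; elim: D s h1 h2 => [|D IHD] s h1 h2 hD.
  by exists 1 => x xs; rewrite conjg1 -[leqRHS]addn0 hD.
have [[x0 [x0s lx0]]|no] := pselect (exists x, x \in s /\ (B + 2 < len x)%N); last first.
  exists 1 => x xs; rewrite conjg1 leqNgt; apply/negP => lx; apply: no; by exists x.
have ncyc x : x \in s -> (B < len x)%N -> ~~ cyc x.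
  by move=> xs lx; apply/negP => /tau_cyc e; have := h1 _ xs; rewrite e leqNgt lx.
have [l [fx0 lx0']] := not_cycP (ncyc _ x0s (leq_ltn_trans (leq_addr _ _) lx0)).
have same x : x \in s -> (B < len x)%N ->
   ohead (nf x) = Some l /\ olast (nf x) = Some (inv_letter l).
  move=> xs lx; have [k [fx lx']] := not_cycP (ncyc _ xs lx).
  have [<- //|kl] := eqVneq k l.
  have xx0 : nocancel x x0.
    by rewrite /nocancel lx' fx0 /= inv_letterK eq_sym.
  have x0x : nocancel x0 x by rewrite /nocancel lx0' fx /= inv_letterK.
  have e := nfM_nocancel xx0.
  have n0 z : (B < len z)%N -> nf z <> [::] by rewrite lenE; case: nf.
  have cz : cyc (x * x0).
    by rewrite cycE /nocancel e olast_cat_neq0 ?ohead_cat_neq0 //; apply: n0; lia.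
  have := h2 _ _ xs x0s; rewrite (tau_cyc cz) lenE e size_cat -!lenE; lia.
have [|||v vP] := IHD [seq x ^ letter_val a l | x <- s].
- by move=> _ /mapP[x xs ->]; rewrite tauJ h1.
- by move=> _ _ /mapP[x xs ->] /mapP[y ys ->]; rewrite -conjMg tauJ h2.
- move=> _ /mapP[x xs ->]; have [lx|lx] := ltnP B (len x).
    have [f1 f2] := same _ xs lx; have := conj_ends f1 f2; have := hD _ xs; lia.
  have := len_conj_letter x l; lia.
exists (letter_val a l * v) => x xs; rewrite conjgM; apply: vP.
by apply/mapP; exists x.
Qed.

(** * Finite-index subgroups *)
Lemma index_map (G : groupType) (H : groupClosed G) d : has_index H d ->
  exists k : G -> 'I_d, forall x y, k x = k y <-> x^-1 * y \in H.
Proof.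
move=> /pcard_eqP[f]; pose C (x : G) : set G := [set y | x^-1 * y \in H]%classic.
have fd x : (f (C x) < d)%N by have := @funS _ _ _ _ f (C x); apply; exists x.
have CE x y : C x = C y <-> x^-1 * y \in H.
  split=> [e|xy].
    have : C y y by rewrite /C /= mulVg gpred1.
    by rewrite -e.
  apply/seteqP; split=> z /= xz.
    change (y^-1 * z \in H); have -> : y^-1 * z = (x^-1 * y)^-1 * (x^-1 * z) by rewrite invgM invgK !mulgA mulgK.
    by rewrite gpredM // gpredV.
  change (x^-1 * z \in H); have -> : x^-1 * z = (x^-1 * y) * (y^-1 * z) by rewrite mulgA mulgK.
  by rewrite gpredM.
exists (fun x => Ordinal (fd x)) => x y; rewrite -CE; split=> [[e]|e].
   apply: (@inj _ _ _ f _ _ _ _ e); apply: mem_set; [by exists x|by exists y].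
by apply: val_inj; rewrite /= e.
Qed.

Lemma index_gt0 (G : groupType) (H : groupClosed G) d : has_index H d -> (0 < d)%N.
Proof. by move/index_map=> [k _]; apply: leq_ltn_trans (ltn_ord (k 1)). Qed.

(** Two of the first d + 1 powers of u lie in the same coset. *)
Lemma expg_fact_index (G : groupType) (H : groupClosed G) d e (u : G) :
  has_index H d -> (d <= e)%N -> u ^+ e`! \in H.
Proof.
move/index_map=> [k kP] de.
have /injectivePn[i [j ij kij]] : ~~ injectiveb (fun i : 'I_d.+1 => k (u ^+ i)).
  by apply/negP => /injectiveP/leq_card; rewrite !card_ord ltnn.
wlog lt : i j ij kij / (i < j)%N => [W|].
  move: (ij); rewrite -val_eqE neq_ltn => /orP[lt|lt]; first exact: (W i j).
  by apply: (W j i) => //; rewrite eq_sym.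
have uH : u ^+ (j - i) \in H.
  rewrite expgnFr ?(ltnW lt) //; have /kP := kij.
  suff -> : u ^- i * u ^+ j = u ^+ j * u ^- i by [].
  by apply: commuteX; apply: commute_sym; apply: commuteV; apply: commuteX.
have /dvdnP[m ->] : (j - i %| e`!)%N.
  apply: dvdn_fact; rewrite subn_gt0 lt /=; have := ltn_ord j; lia.
by rewrite mulnC expgnA gpredXn.
Qed.

(** * Balls in the free group *)
Definition ball n : seq F :=
  iter n (fun s => [seq x * y | x <- s, y <- 1 :: [seq letter_val a l | l <- enum {: letter}]]) [:: 1].

Lemma size_ball n : size (ball n) = (N.*2.+1 ^ n)%N.
Proof.
elim: n => // n IHn; rewrite /ball iterS size_allpairs -/(ball n) IHn expnSr.
by rewrite /= size_map -cardE card_prod card_ord card_bool muln2.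
Qed.

Lemma ballP n g : (g \in ball n) = (len g <= n)%N.
Proof.
apply/idP/idP.
  elim: n g => [|n IHn] g; first by rewrite inE => /eqP ->; rewrite len1.
  rewrite /ball iterS => /allpairsP[[x y] /= [xb yb ->]].
  have {}xb := IHn _ xb; apply: leq_trans (lenM _ _) _; rewrite -addn1 leq_add //.
  move: yb; rewrite inE => /orP[/eqP ->|/mapP[l _ ->]]; first by rewrite len1.
  by rewrite -word_val1 len_word.
elim: n g => [|n IHn] g; first by rewrite leqn0 => /eqP/len_eq0 ->; rewrite inE.
case/lastP E : (nf g) => [|w l] gn; rewrite /ball iterS; apply/allpairsP.
  exists (1, 1); rewrite /= mulg1 inE eqxx; split=> //.
    by apply: IHn; rewrite len1.
  by rewrite -[g]nfK E word_val_nil.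
exists (word_val a w, letter_val a l); split=> /=.
- by apply: IHn; rewrite (leq_trans (len_word _)) //; move: gn; rewrite lenE E size_rcons.
- by rewrite inE map_f ?orbT // mem_enum.
- exact: nf_rcons.
Qed.

(** * The combination tree *)
(** The key inequality survives every embedding, since embeddings preserve
    non-commutation; this is what the following relation records. *)
Definition embedding (H : groupClosed F) (psi : F -> F) :=
  hom_on H psi /\ {in H &, injective psi}.

Definition controls (H : groupClosed F) (g x : F) :=
  exists c, forall psi, embedding H psi -> (tau (psi x) <= c * tau (psi g))%N.

Lemma controls_trans H g x y : controls H g x -> controls H x y -> controls H g y.
Proof.
move=> [c cP] [d dP]; exists (d * c)%N => psi e.
by rewrite (leq_trans (dP _ e)) // -mulnA leq_mul2l cP ?orbT.
Qed.

(** If x and y commute they have a common power, and x alone controls both. *)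
Lemma combine_pair (x y : F) : x <> 1 -> y <> 1 -> exists g,
  [/\ g <> 1, (len g <= 5 * len x + 5 * len y)%N &
   forall H : groupClosed F, x \in H -> y \in H ->
     [/\ g \in H, controls H g x & controls H g y]].
Proof.
move=> x1 y1; have [xy|nc] := pselect (commute x y).
  exists x; split=> //; first lia.
  move=> H xH yH; split=> //; first by exists 1%N => psi _; rewrite mul1n.
  have [i [j ij]] := common_power x1 y1 xy; exists j.+1 => psi [psiM _].
  rewrite -tauX -(hom_onX psiM _ xH); apply: (@leq_trans (tau (psi (y ^+ i.+1)))).
    by rewrite (hom_onX psiM _ yH) tauX leq_pmull.
  by case: ij => ->; rewrite ?(hom_onV psiM) ?gpredXn ?tauV.
exists (x ^+ 5 * y ^+ 5); split.
- move=> e; apply: nc; apply: (@commute_root _ _ 4); apply: commute_sym.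
  have -> : x ^+ 5 = y ^- 5 by apply: (mulIg (y ^+ 5)); rewrite e mulVg.
  exact/commuteV/commuteX/commute_refl.
- by apply: leq_trans (lenM _ _) _; rewrite leq_add // lenX_le.
move=> H xH yH; split.
- by rewrite gpredM ?gpredXn.
all: exists 1%N => psi [psiM psiI]; rewrite mul1n psiM ?gpredXn // !(hom_onX psiM) //.
all: have nc' : ~ commute (psi x) (psi y)
  by rewrite /commute -!psiM // => /psiI e; apply: nc; apply: e; rewrite gpredM.
all: by have [] := tau_combine nc'.
Qed.

(** Combining along a balanced binary tree multiplies the length by 10 at each of the D
    levels, so the total length is polynomial in the number of elements. *)
Lemma combine_list D (s : seq F) l : s <> [::] -> (size s <= 2 ^ D)%N ->
  (forall x, x \in s -> x <> 1 /\ (len x <= l)%N) ->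
  exists g, [/\ g <> 1, (len g <= 10 ^ D * l)%N &
    forall H : groupClosed F, (forall x, x \in s -> x \in H) ->
      g \in H /\ forall x, x \in s -> controls H g x].
Proof.
elim: D s => [|D IHD] s s0 sz sP.
  case: s s0 sz sP => [|x [|]] // _ _ sP; have [x1 xl] := sP x (mem_head _ _).
  exists x; split; rewrite ?mul1n // => H xH; split; first exact/xH/mem_head.
  by move=> y; rewrite inE => /eqP ->; exists 1%N => psi _; rewrite mul1n.
have [le|gt] := leqP (size s) (2 ^ D).
  have [g [g1 gl gP]] := IHD s s0 le sP; exists g; split=> //.
  by rewrite (leq_trans gl) // leq_mul2r leq_exp2l // leqnSn orbT.
pose s1 := take (2 ^ D) s; pose s2 := drop (2 ^ D) s.
have sz1 : size s1 = (2 ^ D)%N by rewrite size_takel // ltnW.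
have [|||g1 [g11 g1l g1P]] := IHD s1.
- by move=> e; move: sz1; rewrite e /= => /esym/eqP; rewrite expn_eq0.
- by rewrite sz1.
- by move=> x /mem_take; exact: sP.
have [|||g2 [g21 g2l g2P]] := IHD s2.
- by move=> /(congr1 size); rewrite size_drop /= => /eqP; rewrite subn_eq0 leqNgt gt.
- by rewrite size_drop leq_subLR addnn -mul2n -expnS.
- by move=> x /mem_drop; exact: sP.
have [g [gn1 gl gP]] := combine_pair g11 g21.
exists g; split=> //; first by rewrite expnS; lia.
move=> H sH.
have [|g1H g1c] := g1P H; first by move=> x /mem_take/sH.
have [|g2H g2c] := g2P H; first by move=> x /mem_drop/sH.
have [gH c1 c2] := gP H g1H g2H; split=> // x.
rewrite -(cat_take_drop (2 ^ D) s) mem_cat => /orP[xs|xs].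
  exact: controls_trans c1 (g1c x xs).
exact: controls_trans c2 (g2c x xs).
Qed.

Definition word_bound d := (10 ^ (N.*2.+1 * (4 * d)) * (d`! * (4 * d)))%N.

(** The (d!)-th powers lie in every subgroup of index at most d, whatever the subgroup
    is; combining those of all elements of length at most 4 d gives an element that
    works for all these subgroups at once.  The bound 4 d covers the products of two
    Schreier generators.  Passing to a root makes it a nonpower. *)
Lemma controlling_element d : (0 < d)%N -> (0 < N)%N -> exists h,
  [/\ h <> 1, ~ proper_power h, (len h <= word_bound d)%N &
   forall (H : groupClosed F) e, has_index H e -> (e <= d)%N -> h \in H ->
     forall u, u \in H -> (len u <= 4 * d)%N -> controls H h u].
Proof.
move=> d0 N0; pose s := [seq u ^+ d`! | u <- ball (4 * d) & u != 1].
have [k kE] : exists k, d`! = k.+1 by exists d`!.-1; rewrite prednK // fact_gt0.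
have [|||g [g1 gl gP]] := @combine_list (N.*2.+1 * (4 * d)) s (d`! * (4 * d)).
- pose x := a (Ordinal N0).
  have x1 : x <> 1.
    have /nf_word e : reduced [:: (Ordinal N0, true)] by [].
    by move=> x1; move: e; rewrite word_val1 /letter_val /= -/x x1 nf1.
  have : x ^+ d`! \in s.
    apply: map_f; rewrite mem_filter; apply/andP; split; first exact/eqP.
    rewrite ballP; have := len_word [:: (Ordinal N0, true)].
    by rewrite word_val1 /letter_val /= -/x; lia.
  by case: s.
- rewrite size_map size_filter (leq_trans (count_size _ _)) // size_ball [leqRHS]expnM leq_exp2r.
    exact/ltnW/ltn_expl.
  by rewrite muln_gt0.
- move=> _ /mapP[u + ->]; rewrite mem_filter ballP => /andP[/eqP u1 lu]; split.
    by rewrite kE => /torsion_free.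
  by rewrite (leq_trans (lenX_le _ _)) // leq_mul2l lu orbT.
have [h [m [np gE hl]]] := nonpower_root g1.
exists h; split=> //.
- by move=> h1; apply: g1; rewrite gE h1 expg1n.
- exact: leq_trans hl gl.
move=> H e He ed hH u uH lu.
have [|gH gc] := gP H.
  by move=> _ /mapP[v _ ->]; exact: expg_fact_index He ed.
have hg : controls H h g.
  by exists m.+1 => psi [psiM _]; rewrite gE (hom_onX psiM) // tauX.
apply: controls_trans hg _.
have [->|u1] := eqVneq u 1.
  by exists 0%N => psi [psiM _]; rewrite (hom_on1 psiM) tau1.
apply: (@controls_trans _ _ (u ^+ d`!)); last first.
  by exists 1%N => psi [psiM _]; rewrite mul1n (hom_onX psiM) // tauX leq_pmull // fact_gt0.
by apply: gc; apply: map_f; rewrite mem_filter u1 ballP.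
Qed.

(** * Short generators and rigidity *)
(** In a shortest word for an element of the coset x H, no two suffixes lie in the same
    left coset, otherwise the part between them could be removed. *)
Lemma short_representative (H : groupClosed F) d x : has_index H d ->
  exists r, (len r < d)%N /\ x^-1 * r \in H.
Proof.
move=> Hd; have d0 := index_gt0 Hd; have [k kP] := index_map Hd.
pose P n := `[< exists w, size w = n /\ x^-1 * word_val a w \in H >].
have exP : exists n, P n.
  by have [w wx] := word_val_surj x; exists (size w); apply/asboolP; exists w; rewrite wx mulVg gpred1.
case: (ex_minnP exP) => n /asboolP[w [wn wH]] nmin; exists (word_val a w); split=> //.
apply: leq_ltn_trans (len_word _) _; rewrite ltnNge; apply/negP => dw.
have /injectivePn[i [j ij kij]] :
    ~~ injectiveb (fun i : 'I_(size w).+1 => k (word_val a (drop i w))).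
  by apply/negP => /injectiveP/leq_card; rewrite !card_ord leqNgt ltnS dw.
wlog lt : i j ij kij / (i < j)%N => [W|].
  move: (ij); rewrite -val_eqE neq_ltn => /orP[lt|lt]; first exact: (W i j).
  by apply: (W j i) => //; rewrite eq_sym.
have /nmin : P (size (take i w ++ drop j w)).
  apply/asboolP; exists (take i w ++ drop j w); split=> //.
  rewrite word_val_cat.
  have -> : x^-1 * (word_val a (take i w) * word_val a (drop j w)) =
     (x^-1 * word_val a w) * ((word_val a (drop i w))^-1 * word_val a (drop j w)).
    have -> : word_val a w = word_val a (take i w) * word_val a (drop i w).
      by rewrite -word_val_cat cat_take_drop.
    by rewrite !mulgA mulgK.
  by rewrite gpredM //; apply/kP.
rewrite -wn size_cat size_takel ?size_drop; last by have := ltn_ord i; lia.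
by have := ltn_ord j; lia.
Qed.

(** Schreier's generators built from the short coset representatives. *)
Lemma short_generation (H : groupClosed F) d (P : F -> Prop) : has_index H d ->
  (forall x y, P x -> P y -> P (x * y)) ->
  (forall u, u \in H -> (len u <= 2 * d)%N -> P u) ->
  forall x, x \in H -> P x.
Proof.
move=> Hd PM PH; have d0 := index_gt0 Hd.
have [r rP] := choice (fun x => short_representative x Hd).
have rH x : (r x)^-1 * x \in H by rewrite -gpredV invgM invgK; case: (rP x).
have rl x : (len (r x) < d)%N by case: (rP x).
have step w : P ((r (word_val a w))^-1 * word_val a w).
  elim: w => [|l w IHw].
    apply: PH; first exact: rH.
    rewrite word_val_nil mulg1 lenV; have := rl 1; glia.
  rewrite word_val_cons.
  set x := word_val a w in IHw *; set y := letter_val a l * x.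
  have -> : (r y)^-1 * y = ((r y)^-1 * letter_val a l * r x) * ((r x)^-1 * x).
    by rewrite !mulgA mulgK -!mulgA.
  apply: PM => //; apply: PH.
    have -> : (r y)^-1 * letter_val a l * r x = ((r y)^-1 * y) * (x^-1 * r x).
      by rewrite /y !mulgA mulgK.
    by rewrite gpredM //; case: (rP x).
  have ll : (len (letter_val a l) <= 1)%N by rewrite -word_val1 len_word.
  have ry := rl y; have rx := rl x.
  apply: (leq_trans (lenM _ _)); apply: (leq_trans (leq_add (lenM _ _) (leqnn _))).
  by rewrite lenV; lia.
move=> x xH; have [w wx] := word_val_surj x.
rewrite -(mulVKg (r x) x); apply: PM; last by have := step w; rewrite wx.
apply: PH; last by have := rl x; lia.
by rewrite -[r x](mulVKg x) gpredM //; case: (rP x).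
Qed.

Lemma uniform_bound (T : eqType) (s : seq T) (Q : T -> nat -> Prop) :
  (forall x m n, (m <= n)%N -> Q x m -> Q x n) ->
  (forall x, x \in s -> exists c, Q x c) -> exists B, forall x, x \in s -> Q x B.
Proof.
move=> mono; elim: s => [|x s IHs] h; first by exists 0%N.
have [|B BP] := IHs; first by move=> y ys; apply: h; rewrite inE ys orbT.
have [c cP] := h x (mem_head _ _); exists (maxn c B) => y.
rewrite inE => /orP[/eqP ->|ys]; first exact: mono (leq_maxl _ _) cP.
exact: mono (leq_maxr _ _) (BP _ ys).
Qed.

(** The images of the generators of H and of their products of two factors have bounded
    translation length, so after conjugation the images of the generators are bounded
    in length, uniformly in n.  There are finitely many possibilities, and two of the
    embeddings agree up to conjugation. *)
Lemma embeddings_conjugate (H : groupClosed F) d h (psi : nat -> F -> F) :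
  has_index H d ->
  (forall u, u \in H -> (len u <= 4 * d)%N -> controls H h u) ->
  (forall n, embedding H (psi n)) -> (forall n, psi n h = h) ->
  exists n n' v, (n < n')%N /\ forall x, x \in H -> psi n' x = (psi n x) ^ v.
Proof.
move=> Hd ch ep eh.
have [B BP] : exists B, forall u, u \in ball (4 * d) -> u \in H ->
    forall n, (tau (psi n u) <= B)%N.
  apply: (@uniform_bound _ _ (fun u B => u \in H -> forall n, (tau (psi n u) <= B)%N)).
    by move=> x m n mn h1 xH k; apply: leq_trans (h1 xH k) mn.
  move=> u; rewrite ballP => lu; have [uH|uH] := boolP (u \in H); last by exists 0%N.
  have [c cP] := ch _ uH lu; exists (c * tau h)%N => _ n.
  by have := cP _ (ep n); rewrite eh.
pose s := [seq u <- ball (2 * d) | u \in H].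
have sH u : u \in s -> u \in H by rewrite mem_filter => /andP[].
have sl u : u \in s -> (len u <= 2 * d)%N by rewrite mem_filter ballP => /andP[].
have /choice[v vP] n : exists v, forall x, x \in s -> (len (psi n x ^ v) <= B + 2)%N.
  have [||v vP] := @coarse_helly [seq psi n x | x <- s] B.
  - move=> _ /mapP[x xs ->]; apply: BP; last exact: sH.
    by rewrite ballP; have := sl _ xs; lia.
  - move=> _ _ /mapP[x xs ->] /mapP[y ys ->]; rewrite -(ep n).1 ?sH //.
    apply: BP; last by rewrite gpredM ?sH.
    rewrite ballP; apply: leq_trans (lenM _ _) _.
    by have := sl _ xs; have := sl _ ys; lia.
  by exists v => x xs; apply: vP; apply/mapP; exists x.
pose K := size (ball (B + 2)).
pose code n : {ffun 'I_(size s) -> 'I_K.+1} :=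
  [ffun i : 'I_(size s) => inord (index (psi n (nth 1 s i) ^ v n) (ball (B + 2)))].
have /injectivePn[i [j ij cij]] :
    ~~ injectiveb (fun i : 'I_(#|{ffun 'I_(size s) -> 'I_K.+1}|).+1 => code i).
  by apply/negP => /injectiveP/leq_card; rewrite card_ord ltnn.
wlog lt : i j ij cij / (i < j)%N => [W|].
  move: (ij); rewrite -val_eqE neq_ltn => /orP[lt|lt]; first exact: (W i j).
  by apply: (W j i) => //; rewrite eq_sym.
exists i, j, (v i * (v j)^-1); split=> // x.
have vij u : u \in s -> psi i u ^ v i = psi j u ^ v j.
  move=> us; have lt' : (index u s < size s)%N by rewrite index_mem.
  have := congr1 (fun f : {ffun _ -> _} => val (f (Ordinal lt'))) cij.
  rewrite /code !ffunE /= nth_index //.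
  have inb n : psi n u ^ v n \in ball (B + 2) by rewrite ballP vP.
  rewrite !inordK ?ltnS ?index_size // => e.
  by rewrite -(nth_index 1 (inb i)) e nth_index.
move=> xH; suff [] : x \in H /\ psi j x = psi i x ^ (v i * (v j)^-1) by [].
pose P x := x \in H /\ psi j x = psi i x ^ (v i * (v j)^-1).
apply: (@short_generation H d P Hd) => //.
- move=> y z [yH ey] [zH ez]; split; first by rewrite gpredM.
  by rewrite (ep j).1 // (ep i).1 // ey ez conjMg.
- move=> u uH lu; split=> //; rewrite conjgM vij ?conjgK //.
  by rewrite mem_filter uH ballP.
Qed.

(** * Splittings and twists *)
Section Twists.
Variables (H : groupClosed F) (d : nat) (h : subgroup H).
Hypothesis Hd : has_index H d.
Hypothesis h1 : h <> 1.
Hypothesis hC : forall u, u \in H -> (len u <= 4 * d)%N -> controls H (val h) u.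
Notation G := (subgroup H).
Implicit Types (x y z t : G) (K L C : groupClosed G).

Lemma sub_val1 : val (1 : G) = 1 :> F.
Proof. exact: (hom1 (val : {multiplicative G -> F})). Qed.

Lemma sub_valM x y : val (x * y) = val x * val y :> F.
Proof. exact: valM. Qed.

Lemma sub_valV x : val x^-1 = (val x)^-1 :> F.
Proof. exact: (homV (val : {multiplicative G -> F})). Qed.

Lemma sub_valX x n : val (x ^+ n) = val x ^+ n :> F.
Proof. exact: (homX (val : {multiplicative G -> F})). Qed.

Lemma sub_valJ x y : val (x ^ y) = val x ^ val y :> F.
Proof. exact: (homJ (val : {multiplicative G -> F})). Qed.

Lemma sub_commute x y : commute (val x) (val y) -> commute x y.
Proof. by rewrite /commute -!sub_valM => /val_inj. Qed.

Lemma commute_val x y : commute x y -> commute (val x) (val y).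
Proof. by rewrite /commute -!sub_valM => ->. Qed.

Lemma sub_neq1 x : x <> 1 -> val x <> 1 :> F.
Proof. by move=> x1 e; apply: x1; apply: val_inj; rewrite e sub_val1. Qed.

Lemma sub_commute_trans x y z : x <> 1 -> commute x y -> commute x z -> commute y z.
Proof.
by move=> /sub_neq1 x1 /commute_val xy /commute_val xz; apply/sub_commute/(commute_trans x1).
Qed.

Lemma sub_torsion_free x k : x ^+ k.+1 = 1 -> x = 1.
Proof.
move=> e; apply: val_inj; apply: (@torsion_free _ k).
by rewrite -sub_valX e sub_val1.
Qed.

Lemma sub_common_root x y : commute x y -> common_root x y.
Proof.
move/commute_val/commute_common_root => [w [wx wy wg]].
have wH : w \in H.
  apply: (wg (fun u => u \in H)); rewrite ?gpred1 //; try exact: valP.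
  - by move=> u v; exact: gpredM.
  - by move=> u; rewrite gpredV.
pose w' : G := Sub w wH.
have wE : w = val w' by rewrite SubK.
have P u : power_of w (val u) -> power_of w' u.
  by move=> [n [e|e]]; exists n; [left|right]; apply: val_inj; rewrite e wE ?sub_valV sub_valX.
exists w'; split; [exact: P|exact: P|].
move=> Q Q1 QM QV Qx Qy.
have [] := wg (fun u => exists uH : u \in H, Q (Sub u uH)).
- have H1 : 1 \in H by exact: gpred1.
  exists H1; have -> : Sub 1 H1 = 1 :> G by apply: val_inj; rewrite SubK sub_val1.
  done.
- move=> u v [uH Qu] [vH Qv]; have uvH : u * v \in H by rewrite gpredM.
  exists uvH; have -> : Sub (u * v) uvH = Sub u uH * Sub v vH :> G.
    by apply: val_inj; rewrite sub_valM !SubK.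
  exact: QM.
- move=> u [uH Qu]; have uVH : u^-1 \in H by rewrite gpredV.
  exists uVH; have -> : Sub u^-1 uVH = (Sub u uH : G)^-1.
    by apply: val_inj; rewrite sub_valV !SubK.
  exact: QV.
- exists (valP x); have -> : Sub (val x) (valP x) = x by apply: val_inj; rewrite SubK.
  done.
- exists (valP y); have -> : Sub (val y) (valP y) = y by apply: val_inj; rewrite SubK.
  done.
move=> wH' Qw; have -> : w' = Sub w wH' by apply: val_inj; rewrite !SubK.
done.
Qed.

(** The conjugating element v is only found in F, not in H; the arguments
    below compute in F for this reason. *)
Lemma twists_conjugate (phi : nat -> {multiplicative G -> G}) :
  (forall n, injective (phi n)) -> (forall n, phi n h = h) ->
  exists n j v, forall x, val (phi (n + j.+1)%N x) = (val (phi n x)) ^ v.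
Proof.
move=> phiI phih.
pose psi n (u : F) : F := if insub u is Some x then val (phi n x) else 1.
have psiE n x : psi n (val x) = val (phi n x) by rewrite /psi valK.
have psiH n u (uH : u \in H) : psi n u = val (phi n (Sub u uH)).
  by rewrite -psiE SubK.
have [||n [n' [v [lt vP]]]] := @embeddings_conjugate H d (val h) psi Hd hC.
- move=> n; split=> u w uH wH.
    have uwH : u * w \in H by rewrite gpredM.
    rewrite (psiH n u uH) (psiH n w wH) (psiH n _ uwH) -sub_valM -gmulfM.
    congr (val (phi n _)); apply: val_inj; by rewrite sub_valM !SubK.
  rewrite (psiH n u uH) (psiH n w wH) => /val_inj/phiI/(congr1 val).
  by rewrite !SubK.
- by move=> n; rewrite psiE phih.
exists n, (n' - n).-1, v => x; rewrite -!psiE -vP; last exact: valP.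
by congr (psi _ _); lia.
Qed.

(** The twists t |-> z^n t are automorphisms fixing h.  If two of them differ by
    conjugation by v, then v commutes with z and with a nontrivial power of z that
    equals v^-1 * v ^ (t^-1); so v commutes with its conjugate by t^-1, hence with t,
    and that power of z is trivial. *)
Lemma no_HNN_twist K C C' t z : HNN_extension K C C' t -> h \in K -> z \in K ->
  z <> 1 -> (forall x, x \in C -> commute z x) -> False.
Proof.
move=> [CK C'K CC' UP] hK zK z1 zC.
have tw (u : G) : (u = z \/ u = z^-1) -> forall n, exists f : {multiplicative G -> G},
    {in K, forall x, f x = x} /\ f t = u ^+ n * t.
  move=> uz n; have [||f [f1 f2 _]] := UP G (fun x => x) (u ^+ n * t); last by exists f.
    by move=> x y.
  move=> x xC; rewrite conjgM; congr (_ ^ t); apply/esym/conjg_fixP/commgP.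
  apply/commuteX; case: uz => ->; last apply/commuteV; exact/commute_sym/zC.
have [phi phiP] := choice (tw z (or_introl erefl)).
have [psi psiP] := choice (tw z^-1 (or_intror erefl)).
have psiK n : cancel (phi n) (psi n).
  have [||f [_ _ fU]] := UP G (fun x => x) t => //.
  pose g1 : {multiplicative G -> G} := psi n \o phi n.
  pose g2 : {multiplicative G -> G} := idfun.
  have e2 : g2 =1 f by apply: fU.
  have e1 : g1 =1 f.
    apply: fU; first by move=> y yK; rewrite /g1 /= (phiP n).1 // (psiP n).1.
    rewrite /g1 /= (phiP n).2 gmulfM (psiP n).2 homX (psiP n).1 // expVgn.
    by rewrite mulVKg.
  by move=> x; rewrite [LHS](e1 x) -(e2 x).
have [n [j [v vP]]] := @twists_conjugate phi (fun n => can_inj (psiK n)) (fun n => (phiP n).1 _ hK).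
have vz : commute v (val z).
  have := vP z; rewrite !(phiP _).1 // => e.
  by rewrite /commute {1}e conjgE mulVKg.
have := vP t; rewrite !(phiP _).2 !sub_valM !sub_valX => e.
have ez : val z ^+ j.+1 = v^-1 * v ^ (val t)^-1.
  have vzn : commute v^-1 (val z ^+ n).
    by apply/commuteX; apply: commute_sym; apply/commuteV/commute_sym.
  move: e; rewrite expgnDr !conjgE invgK -!mulgA => e.
  apply: (mulgI (val z ^+ n)); apply: (mulIg (val t)); rewrite -!mulgA e.
  by rewrite mulVg mulg1 !mulgA vzn.
have vt : commute v (v ^ (val t)^-1).
  rewrite -(mulVKg v (v ^ _)) -ez; apply: commuteM; first exact: commute_refl.
  exact: commuteX.
have := commute_conj vt => /commgP; rewrite -conjg_fix => /eqP e2.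
apply: z1; apply: (@sub_torsion_free _ j); apply: val_inj.
by rewrite sub_valX ez e2 mulVg sub_val1.
Qed.

(** The twists are the identity on K and conjugation by z^n on L. *)
Lemma amalgam_twist K L C z : amalgamated_product K L C -> h \in K ->
  (z \in K) || (z \in L) -> (forall x, x \in C -> commute z x) ->
  exists n j v, (forall x, x \in K -> commute (val x) v) /\
    (forall x, x \in L -> commute (val x) (val z ^+ n * v * val z ^- (n + j.+1))).
Proof.
move=> [CK CL UP] hK zKL zC.
have tw (u : G) : (u = z \/ u = z^-1) -> forall n, exists f : {multiplicative G -> G},
    {in K, forall x, f x = x} /\ {in L, forall x, f x = x ^ (u ^+ n)}.
  move=> uz n; have [|||f [f1 f2 _]] := UP G (fun x => x) (fun x => x ^ (u ^+ n)).
  - by move=> x y.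
  - by move=> x y _ _ /=; rewrite conjMg.
  - move=> x xC; apply/esym/conjg_fixP/commgP.
    apply/commuteX; case: uz => ->; last apply/commuteV; exact/commute_sym/zC.
  by exists f.
have [phi phiP] := choice (tw z (or_introl erefl)).
have [psi psiP] := choice (tw z^-1 (or_intror erefl)).
have psiz n : psi n z = z.
  case/orP: zKL => zK; first exact: (psiP n).1.
  rewrite (psiP n).2 //; apply/conjg_fixP/commgP.
  exact/commuteX/commuteV/commute_refl.
have psiK n : cancel (phi n) (psi n).
  have [|||f [_ _ fU]] := UP G (fun x => x) (fun x => x) => //.
  pose g1 : {multiplicative G -> G} := psi n \o phi n.
  pose g2 : {multiplicative G -> G} := idfun.
  have e2 : g2 =1 f by apply: fU.
  have e1 : g1 =1 f.
    apply: fU; first by move=> y yK; rewrite /g1 /= (phiP n).1 // (psiP n).1.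
    move=> y yL; rewrite /g1 /= (phiP n).2 // homJ homX psiz (psiP n).2 // -conjgM.
    by rewrite expVgn mulVg conjg1.
  by move=> x; rewrite [LHS](e1 x) -(e2 x).
have [n [j [v vP]]] := @twists_conjugate phi (fun n => can_inj (psiK n)) (fun n => (phiP n).1 _ hK).
exists n, j, v; split=> x xK.
  have := vP x; rewrite !(phiP _).1 // => e.
  by rewrite /commute {2}e conjgE mulVKg.
have := vP x; rewrite !(phiP _).2 // !sub_valJ.
rewrite !sub_valX -conjgM => e.
rewrite /commute conjgC; congr (_ * _).
by rewrite conjgM -e conjgK.
Qed.

(** Together with the generator, such an element lies in a cyclic subgroup, which
    maximality makes equal to C. *)
Lemma maximal_cyclic_centralizer C z x : maximal_cyclic_subgroup C ->
  (forall x, x \in C <-> power_of z x) -> commute z x -> x \in C.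
Proof.
move=> [_ Cmax] Cz zx; have [w [wz wx _]] := sub_common_root zx.
have [|||D DE] := @prop_subgroup G (power_of w).
- exact: power_of1.
- by move=> u v; exact: power_ofM.
- by move=> u; exact: power_ofV.
rewrite -(Cmax D); first exact/DE.
  by exists w.
move=> u /Cz uz; apply/DE; case: uz wz => n uE wz.
have [m zE] := wz; exists (m * n)%N.
by case: uE => ->; case: zE => ->; rewrite ?expVgn ?invgK expgnA; [left|right|right|left].
Qed.

Lemma maximal_cyclic_gen C : maximal_cyclic_subgroup C ->
  exists z, z <> 1 /\ forall x, x \in C <-> power_of z x.
Proof.
move=> Cm; have [[z Cz] _] := Cm; exists z; split=> // z1; apply: h1.
have : h \in C.
  apply: (maximal_cyclic_centralizer Cm Cz); rewrite z1; exact/commute_sym/commute1.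
by move/Cz => [n [->|->]]; rewrite z1 expg1n ?invg1.
Qed.

(** A shortest nontrivial element b is a generator: b and x have a common root in L,
    which would be shorter than b if b were a proper power of it. *)
Lemma abelian_cyclic L : (exists2 x, x \in L & x <> 1) ->
  (forall x y, x \in L -> y \in L -> commute x y) ->
  exists b, [/\ b \in L, b <> 1 & forall x, x \in L <-> power_of b x].
Proof.
move=> [x0 x0L x01] ab.
pose P n := `[< exists x, [/\ x \in L, x <> 1 & len (val x) = n] >].
have exP : exists n, P n by exists (len (val x0)); apply/asboolP; exists x0.
case: (ex_minnP exP) => n /asboolP[b [bL b1 bn]] nmin; exists b; split=> // x.
split=> [xL|[k [->|->]]]; last 2 first.
- by rewrite gpredXn.
- by rewrite gpredV gpredXn.
have [w [wb wx wg]] := sub_common_root (ab _ _ bL xL).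
have wL : w \in L.
  apply: (wg (fun u => u \in L)) => //; rewrite ?gpred1 //.
  - by move=> u v; exact: gpredM.
  - by move=> u; rewrite gpredV.
have w1 : w <> 1 by move=> w1; case: wb b1 => k [->|->]; rewrite w1 expg1n ?invg1.
have lw : (len (val b) <= len (val w))%N by rewrite bn; apply: nmin; apply/asboolP; exists w.
have wE : w = b \/ w = b^-1.
  case: wb => k bE; have lb : len (val b) = len (val w ^+ k).
    by case: bE => ->; rewrite ?sub_valV ?lenV sub_valX.
  case: k bE lb => [|[|k]] bE lb.
  - by case: bE b1 => ->; rewrite expg0 ?invg1.
  - by case: bE => ->; [left|right]; rewrite ?invgK expg1.
  - by have := len_expS k.+1 (sub_neq1 w1); rewrite -lb; move: lw; glia.
case: wE => wE; rewrite wE in wx => //.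
by case: wx => k [->|->]; exists k; rewrite expVgn ?invgK; [right|left].
Qed.

(** A homomorphism from the infinite cyclic group L to Q with prescribed value s at b is
    obtained from its graph, the cyclic subgroup of G * Q generated by (b, s). *)
Lemma free_product_HNN K L C b : amalgamated_product K L C -> trivial_subgroup C ->
  b <> 1 -> (forall x, x \in L <-> power_of b x) -> HNN_extension K C C b.
Proof.
move=> [CK CL UP] C1 b1 Lb; split=> //.
  by move=> x; rewrite !C1 !inE conjg_eq1.
move=> Q f s fM _.
pose f' x := xget 1 [set q : Q | power_of ((b, s) : G * Q) (x, q)]%classic.
have pairX n : ((b, s) : G * Q) ^+ n = (b ^+ n, s ^+ n).
  by elim: n => // n IHn; rewrite !expgS IHn.
have fun1 q : power_of ((b, s) : G * Q) (1, q) -> q = 1.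
  move=> [n]; rewrite pairX => -[p|p]; have e2 := congr1 snd p; rewrite /= in e2; rewrite e2.
    have e : 1 = b ^+ n := congr1 fst p; case: n e {p e2} => [|n] e; first by rewrite expg0.
    by case: b1; exact: sub_torsion_free (esym e).
  have e : 1 = b ^- n := congr1 fst p; case: n e {p e2} => [|n] e; first by rewrite expg0 invg1.
  by case: b1; apply: (@sub_torsion_free _ n); apply: invg_inj; rewrite invg1 -e.
have funq x q q' : power_of ((b, s) : G * Q) (x, q) -> power_of ((b, s) : G * Q) (x, q') -> q = q'.
  move=> p1 p2; apply: (mulIg q'^-1); rewrite mulgV; apply: fun1.
  by have := power_ofM p1 (power_ofV p2); rewrite /mul /= /mul_pair /= mulgV.
have f'P x : x \in L -> power_of ((b, s) : G * Q) (x, f' x).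
  move=> /Lb xb; have [q qP] : exists q : Q, power_of ((b, s) : G * Q) (x, q).
    by case: xb => n [xE|xE]; [exists (s ^+ n)|exists (s ^- n)]; exists n;
       rewrite pairX xE; [left|right].
  by rewrite /f'; case: xgetP => [z -> //|/(_ q)].
have f'E x q : x \in L -> power_of ((b, s) : G * Q) (x, q) -> f' x = q.
  by move=> xL; apply: funq; exact: f'P.
have bL : b \in L by apply/Lb/power_of_refl.
have [|||g [gK gL gU]] := UP Q f f'.
- by [].
- by move=> x y xL yL; apply: f'E; [rewrite gpredM|exact: (power_ofM (f'P _ xL) (f'P _ yL))].
- move=> x; rewrite C1 inE => /eqP ->; rewrite (hom_on1 fM).
  by apply/esym/f'E; [exact: gpred1|exact: power_of1].
exists g; split=> //; first by rewrite gL //; apply: f'E => //; exact: power_of_refl.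
move=> g' g'K g'b; apply: gU => // x xL; apply/esym/f'E => //.
by have /Lb [n [->|->]] := xL; exists n; rewrite pairX ?homV homX g'b; [left|right].
Qed.

Lemma no_HNN K C C' t : HNN_extension K C C' t -> h \in K ->
  trivial_subgroup C \/ maximal_cyclic_subgroup C -> False.
Proof.
move=> E hK [C1|Cm].
  apply: (no_HNN_twist E hK hK h1) => x; rewrite C1 inE => /eqP ->.
  exact: commute1.
have [z [z1 Cz]] := maximal_cyclic_gen Cm; have [CK _ _ _] := E.
apply: (no_HNN_twist E hK (CK z _) z1); first exact/Cz/power_of_refl.
by move=> x /Cz xz; apply/commute_sym/(power_of_commute xz)/commute_refl.
Qed.

Lemma centralized_abelian (v : F) : v <> 1 -> forall L,
  (forall x, x \in L -> commute (val x) v) -> forall x y, x \in L -> y \in L -> commute x y.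
Proof.
move=> v1 L Lv u w uL wL; apply: sub_commute.
by apply: (commute_trans v1); apply/commute_sym/Lv.
Qed.

(** If C is trivial and L is abelian, the splitting is an HNN extension.  If C is trivial
    and L is not abelian, twist by an element of L that does not commute with h.  If C
    is maximal cyclic, twist by its generator z: if v is nontrivial then its
    centralizer contains K, which is therefore abelian and equal to C; if v is trivial
    then L centralizes a power of z and is equal to C. *)
Lemma no_amalgam K L C : amalgamated_product K L C -> h \in K ->
  ~ C =i K -> ~ C =i L ->
  trivial_subgroup C \/ maximal_cyclic_subgroup C -> False.
Proof.
move=> E hK CK CL [C1|Cm]; have [sCK sCL _] := E.
  have [ab|nab] := pselect (forall x y, x \in L -> y \in L -> commute x y).
    have [|b [bL b1 Lb]] := abelian_cyclic _ ab.
      apply: contrapT => no; apply: CL => x; rewrite C1 inE; apply/eqP/idP => [->|xL].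
        exact: gpred1.
      by apply: contrapT => x1; apply: no; exists x.
    exact: (no_HNN (free_product_HNN E C1 b1 Lb) hK (or_introl C1)).
  have [z zL zh] : exists2 z, z \in L & ~ commute h z.
    apply: contrapT => no; apply: nab => x y xL yL.
    by apply: (sub_commute_trans h1); apply: contrapT => hx; apply: no; [exists x|exists y].
  have [|x|n [j [v [vK vL]]]] := amalgam_twist E hK (z := z).
  - by rewrite zL orbT.
  - rewrite C1 inE => /eqP ->; exact: commute1.
  have [u1|u1] := pselect (val z ^+ n * v * val z ^- (n + j.+1) = 1).
    apply: zh; apply: commute_sym.
    have vE : v = val z ^+ j.+1.
      apply: (mulgI (val z ^+ n)); apply: (mulIg (val z ^- (n + j.+1))).
      by rewrite u1 -expgnDr mulgV.
    apply: sub_commute; apply: (@commute_root _ _ j); rewrite -vE.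
    exact/commute_sym/vK.
  by apply: nab; apply: centralized_abelian u1 _ vL.
have [z [z1 Cz]] := maximal_cyclic_gen Cm.
have zC : z \in C by apply/Cz/power_of_refl.
have zK := sCK _ zC; have zL := sCL _ zC.
have [||n [j [v [vK vL]]]] := amalgam_twist E hK (z := z).
- by rewrite zK.
- by move=> x /Cz xz; apply/commute_sym/(power_of_commute xz)/commute_refl.
have [v1|v1] := pselect (v = 1).
  apply: CL => x; apply/idP/idP => [/sCL //|xL].
  apply: (maximal_cyclic_centralizer Cm Cz).
  have := vL x xL; rewrite v1 mulg1 expgnDr invgM mulgA.
  have -> : val z ^+ n * val z ^- j.+1 * val z ^- n = val z ^- j.+1.
    rewrite -mulgA; apply: (mulIg (val z ^+ n)); rewrite -mulgA mulgVK.
    exact: (commuteV (commuteX2 _ _ (commute_refl _))).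
  move=> c; apply: sub_commute; apply: (@commute_root _ _ j); apply: commute_sym.
  by rewrite -[_ ^+ _]invgK; apply: commuteV.
apply: CK => x; apply/idP/idP => [/sCK //|xK].
apply: (maximal_cyclic_centralizer Cm Cz).
exact: centralized_abelian v1 _ vK _ _ zK xK.
Qed.

Lemma filling : ~ non_filling h.
Proof.
move=> [K [C [hK C1 [[L [E CK CL]]|[C' [t E]]]]]].
  exact: no_amalgam E hK CK CL C1.
exact: no_HNN E hK C1.
Qed.

End Twists.

(** * Every nontrivial element is primitive in a subgroup of finite index *)
Lemma free_ind (P : F -> Prop) : P 1 -> (forall x y, P x -> P y -> P (x * y)) ->
  (forall x, P x -> P x^-1) -> (forall i, P (a i)) -> forall x, P x.
Proof.
move=> P1 PM PV Pa x; have [w <-] := word_val_surj x.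
elim: w => [|[i b] w IHw]; first by rewrite word_val_nil.
by rewrite word_val_cons; apply: PM => //; rewrite /letter_val /=; case: b; [|apply: PV].
Qed.

Section Cycle.
Variables (v c : F) (n' : nat).
Notation n := n'.+1.
Hypotheses (cc : cyc c) (cn : size (nf c) = n).
Notation w := (nf c).
Definition vert k : 'I_n := inord (k %% n).

Lemma vertE k : vert k = (k %% n)%N :> nat.
Proof. by rewrite /vert inordK ?ltn_mod. Qed.

Lemma vertK k : (k < n)%N -> vert k = k :> nat.
Proof. by move=> kn; rewrite /vert inordK ?ltn_mod // modn_small. Qed.

Lemma vert_ord (i : 'I_n) : vert i = i.
Proof. by apply: val_inj; rewrite /= vertK. Qed.

Lemma vertn : vert n = vert 0.
Proof. by rewrite /vert modnn mod0n. Qed.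

Lemma vert_inj k k' : (k < n)%N -> (k' < n)%N -> vert k = vert k' -> k = k'.
Proof. by move=> kn k'n /(congr1 val); rewrite /= !vertK. Qed.

Lemma vertS_inj k k' : (k < n)%N -> (k' < n)%N -> vert k.+1 = vert k'.+1 -> k = k'.
Proof.
move=> kn k'n /(congr1 val); rewrite /= !vertE -[k.+1]addn1 -[k'.+1]addn1 => /eqP.
by rewrite eqn_modDr !modn_small // => /eqP.
Qed.

Lemma vert_turn l0 k k' : (k < n)%N -> (k' < n)%N -> vert k = vert k'.+1 ->
  nth l0 w k != inv_letter (nth l0 w k').
Proof.
move=> kn k'n /(congr1 val); rewrite /= !vertE modn_small //.
have [lt|ge] := ltnP k'.+1 n.
  rewrite modn_small // => ek; have := nf_reduced c.
  rewrite -{1}(cat_take_drop k w) reduced_cat => /and3P[_ _].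
  by rewrite (drop_nth l0) ?cn // ek (take_nth l0) ?cn // olast_rcons.
have -> : k'.+1 = n by apply/eqP; rewrite eqn_leq k'n.
rewrite modnn => ->; have -> : k' = n' by lia.
move: cc; rewrite cycE /nocancel.
case/lastP E : (nf c) cn => [|s l] // sz.
have -> : nth l0 (rcons s l) n' = l.
  by move: sz; rewrite size_rcons => -[<-]; rewrite nth_rcons ltnn eqxx.
by rewrite olast_rcons; case: s {E sz} => [|m s].
Qed.

Lemma cycle_action : exists f : {multiplicative F -> {perm 'I_n}}, forall l0 k, (k < n)%N ->
    f (letter_val a (nth l0 w k)) (vert k) = vert k.+1.
Proof.
have [|||f fP] := @path_action _ w vert; rewrite ?cn.
- exact: vert_inj.
- exact: vertS_inj.
- exact: vert_turn.
- by exists f => l0 k kn; apply: fP; rewrite cn.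
Qed.

Variable f : {multiplicative F -> {perm 'I_n}}.
Hypothesis fP : forall l0 k, (k < n)%N ->
    f (letter_val a (nth l0 w k)) (vert k) = vert k.+1.

Definition stab x := f (x ^ v) (vert 0) == vert 0.

Definition pre (i : 'I_n) := word_val a (take i w).

Lemma preP i : f (pre i) (vert 0) = i.
Proof.
have := @path_trace _ f w vert; rewrite cn => /(_ fP i (ltnW (ltn_ord i))).
by rewrite vert_ord.
Qed.

Lemma pre0 : pre (vert 0) = 1.
Proof. by rewrite /pre vertK // take0 word_val_nil. Qed.

Lemma pre_step l0 k : (k < n')%N ->
  pre (vert k.+1) = pre (vert k) * letter_val a (nth l0 w k).
Proof.
move=> kn; rewrite /pre !vertK ?ltnS //; last exact: ltnW.
by rewrite (take_nth l0) ?cn ?word_val_rcons // ltnS ltnW.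
Qed.

Lemma pre_last l0 : pre (vert n') * letter_val a (nth l0 w n') = c.
Proof.
rewrite /pre vertK // -word_val_rcons -take_nth ?cn // -cn take_size.
exact: nfK.
Qed.

(** The loop that follows the tree from the base point to i, reads y, and returns. *)
Definition based_loop (i : 'I_n) (y : F) := (pre i * y * (pre (f y i))^-1) ^ v^-1.

Lemma based_loopM i y z : based_loop i (y * z) = based_loop i y * based_loop (f y i) z.
Proof.
by rewrite /based_loop -conjMg gmulfM permM; congr (_ ^ _); rewrite !mulgA mulgVK.
Qed.

Lemma based_loop1 i : based_loop i 1 = 1.
Proof. by rewrite /based_loop hom1 perm1 mulg1 mulgV conj1g. Qed.

Lemma based_loopV i y : based_loop i y^-1 = (based_loop (f y^-1 i) y)^-1.
Proof.
apply: (mulIg (based_loop (f y^-1 i) y)); rewrite mulVg -based_loopM mulVg.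
exact: based_loop1.
Qed.

Lemma based_loop_stab i y : stab (based_loop i y).
Proof.
rewrite /stab /based_loop conjgKV !gmulfM !permM preP homV.
by rewrite -[in X in _ == X](permK (f (pre (f y i))) (vert 0)) preP.
Qed.

(** An edge is named by a generator and the vertex where this generator starts, so an
    inverse letter is read backwards. *)
Definition edge (l0 : letter) (k : nat) : 'I_n * 'I_N :=
  let l := nth l0 w k in ((if l.2 then vert k else vert k.+1), l.1).

Lemma based_loop_edge l0 k : (k < n')%N -> based_loop (edge l0 k).1 (a (edge l0 k).2) = 1.
Proof.
move=> kn; have := pre_step l0 kn; have := fP l0 (leq_trans kn (leqnSn _)).
rewrite /edge /based_loop; case: (nth l0 w k) => i [] /=; rewrite /letter_val /= => fk e.
  by rewrite fk e mulgV conj1g.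
rewrite homV in fk.
have -> : f (a i) (vert k.+1) = vert k by rewrite -fk permKV.
by rewrite e mulgVK mulgV conj1g.
Qed.

Lemma based_loop_last l0 :
  based_loop (edge l0 n').1 (a (edge l0 n').2) =
    if (nth l0 w n').2 then c ^ v^-1 else (c ^ v^-1)^-1.
Proof.
have := pre_last l0; have := fP l0 (leqnn _).
rewrite /edge /based_loop; case: (nth l0 w n') => i [] /=; rewrite /letter_val /= => fk ce.
  by rewrite fk vertn pre0 invg1 mulg1 ce.
rewrite homV in fk; rewrite vertn pre0 mul1g in fk *.
have -> : f (a i) (vert 0) = vert n' by rewrite -fk permKV.
by rewrite -conjVg -ce invgM invgK.
Qed.

Lemma edge_inj l0 k k' : (k < n)%N -> (k' < n)%N -> edge l0 k = edge l0 k' -> k = k'.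
Proof.
move=> kn k'n; have := @source_inj _ _ w vert; rewrite cn.
by move/(_ vert_inj vertS_inj vert_turn l0 k k' kn k'n).
Qed.

(** An edge labelling is the same as a homomorphism from F to the wreath product that
    lifts f, and the label of a path is then a coordinate of its image.  With trivial
    labels on the edges of a maximal tree, loops at the base point get the product of
    the labels of the other edges. *)
Section Labels.
Variables (Q : groupType) (lab : 'I_n -> 'I_N -> Q).
Variable Phi : {multiplicative F -> wreath Q 'I_n}.
Hypothesis PhiP : forall j, Phi (a j) = ([ffun i => lab i j], f (a j)).

Lemma Phi_perm x : (Phi x).2 = f x.
Proof.
apply: (@free_ind (fun x => (Phi x).2 = f x)) x.
- by rewrite !hom1.
- by move=> x y ex ey; rewrite !gmulfM -ex -ey.
- by move=> x ex; rewrite !homV -ex.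
- by move=> j; rewrite PhiP.
Qed.

Lemma PhiM x y i : (Phi (x * y)).1 i = (Phi x).1 i * (Phi y).1 (f x i).
Proof. by rewrite gmulfM ffunE Phi_perm. Qed.

Lemma PhiV x i : (Phi x^-1).1 (f x i) = ((Phi x).1 i)^-1.
Proof. by rewrite homV ffunE Phi_perm permK. Qed.

Lemma Phi_letter l0 k : (k < n)%N ->
  (Phi (letter_val a (nth l0 w k))).1 (vert k) =
  let e := edge l0 k in if (nth l0 w k).2 then lab e.1 e.2 else (lab e.1 e.2)^-1.
Proof.
move=> kn; have := fP l0 kn; rewrite /edge; case: (nth l0 w k) => i [] /=; rewrite /letter_val /=.
  by rewrite PhiP ffunE.
rewrite homV => fk; have fk' : f (a i) (vert k.+1) = vert k by rewrite -fk permKV.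
by rewrite -fk' PhiV PhiP ffunE.
Qed.

Hypothesis lab_tree : forall l0 k, (k < n')%N -> lab (edge l0 k).1 (edge l0 k).2 = 1.

Lemma Phi_pre i : (Phi (pre i)).1 (vert 0) = 1.
Proof.
have l0 : letter by case: (nf c) cn.
rewrite -(vert_ord i); have := ltn_ord i; elim: (i : nat) => [|k IHk] kn.
  by rewrite pre0 hom1 ffunE.
rewrite (pre_step l0) // PhiM IHk 1?ltnW // mul1g preP Phi_letter 1?ltnW //=.
by rewrite lab_tree // invg1; case: ifP.
Qed.

Lemma Phi_based_loop i j : (Phi (based_loop i (a j) ^ v)).1 (vert 0) = lab i j.
Proof.
rewrite /based_loop conjgKV !PhiM Phi_pre mul1g preP PhiP ffunE.
rewrite gmulfM permM preP -[X in (Phi (pre X)^-1).1 _]/(f (a j) i).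
by rewrite -{2}(preP (f (a j) i)) PhiV Phi_pre invg1 mulg1.
Qed.

Lemma Phi_c l0 : (Phi c).1 (vert 0) =
  let e := edge l0 n' in if (nth l0 w n').2 then lab e.1 e.2 else (lab e.1 e.2)^-1.
Proof. by rewrite -{1}(pre_last l0) PhiM Phi_pre mul1g preP Phi_letter. Qed.

End Labels.

End Cycle.

Lemma stab_closed v n' (f : {multiplicative F -> {perm 'I_n'.+1}}) :
  exists H : groupClosed F, forall x, x \in H <-> stab v f x.
Proof.
apply: prop_subgroup; rewrite /stab.
- by rewrite conj1g hom1 perm1.
- by move=> x y /eqP ex /eqP ey; rewrite conjMg gmulfM permM ex ey.
- by move=> x /eqP ex; rewrite conjVg homV -{1}ex permK.
Qed.

Lemma card_cosets (H : groupClosed F) n (k : F -> 'I_n) :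
  (forall i, exists x, k x = i) -> (forall x y, k x = k y <-> x^-1 * y \in H) ->
  has_index H n.
Proof.
case: n k => [|n] k ks kP; first by case: (k 1).
have [r rP] := choice ks.
pose D m : set F := [set y | (r (inord m))^-1 * y \in H]%classic.
rewrite /has_index.
have -> : [set A | exists x, A = [set y | x^-1 * y \in H]]%classic = (D @` `I_n.+1)%classic.
  apply/seteqP; split=> [_ [x ->]|_ [m _ <-]] /=; last by exists (r (inord m)).
  exists (k x) => //; apply/seteqP; split=> y /=; rewrite /D /= inord_val.
    by move=> /kP e; apply/kP; rewrite -e rP.
  by move=> /kP e; apply/kP; rewrite rP e.
apply: inj_card_eq => i j /set_mem iI /set_mem jI e.
have : D j (r (inord i)).
  by rewrite -e /D /= mulVg gpred1.
by rewrite /D /= => /kP; rewrite !rP => /(congr1 val); rewrite /= !inordK.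
Qed.

(** The word of a cyclically reduced conjugate c of g labels a circle.  Complete the circle
    to a finite action of F, that is to a finite covering of the rose, without
    new vertices.  All edges of the circle but the last form a maximal tree, so that the
    last edge contributes g, or its inverse, to Schreier's basis of a point stabiliser. *)
Lemma primitive_finite_index g : g <> 1 ->
  exists (H : groupClosed F) (gH : g \in H) d, has_index H d /\ primitive (Sub g gH : subgroup H).
Proof.
move=> g1; have [s [c [cc _ gE]]] := cyclic_reduction g.
pose u := word_val a s.
have {}gE : g = c ^ u^-1 by rewrite gE conjgE invgK mulgA.
have c1 : c <> 1 by move=> c1; apply: g1; rewrite gE c1 conj1g.
have [n' cn] : exists n', size (nf c) = n'.+1.
  by have := len_gt0 c1; rewrite lenE; case: size => // n' _; exists n'.
have [f fP] := cycle_action cc cn.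
have [H HP] := stab_closed u f.
have [l0 _] : exists l0 : letter, True by case: (nf c) cn => // l0; exists l0.
pose G := subgroup H.
have sH x : stab u f x -> x \in H by move=> h; apply/HP.
have loopH i y : based_loop u c f i y \in H by apply/sH/(based_loop_stab u cn fP).
have glast := based_loop_last u cn fP l0.
have gtree k kn := based_loop_edge u cn fP l0 (k := k) kn.
rewrite -gE in glast.
have gH : g \in H.
  move: glast; case: (nth l0 _ _).2 => e; first by rewrite -e loopH.
  by rewrite -[g]invgK -e gpredV loopH.
exists H, gH, n'.+1; split.
  apply: (@card_cosets _ _ (fun x => f (x * u)^-1 (vert n' 0))).
    move=> i; exists ((pre c i)^-1 * u^-1); rewrite mulgVK invgK.
    by have := preP cn fP i.
  move=> x y; rewrite HP /stab.
  have -> : (x^-1 * y) ^ u = (x * u)^-1 * (y * u) by rewrite conjgE invgM !mulgA.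
  rewrite gmulfM permM [f (y * u)^-1]homV; split=> [->|/eqP e]; first by rewrite permKV.
  by apply: (@perm_inj _ (f (y * u))); rewrite permKV.
pose g' : G := Sub g gH.
pose gen i j : G := Sub (based_loop u c f i (a j)) (loopH i (a j)).
pose free_edge i j := forall k, (k < n'.+1)%N -> edge c n' l0 k <> (i, j).
split; first by move=> /(congr1 val); rewrite SubK; exact: g1.
exists [set x | x = g' \/ exists i j, free_edge i j /\ x = gen i j]%classic; last by left.
(* Uniqueness is Schreier's lemma: the based loops of single letters generate H; those
   of tree edges are trivial and that of the closing edge is g or its inverse. *)
have uniq_hom (Q : groupType) (f1 f2 : {multiplicative G -> Q}) : f1 g' = f2 g' ->
    (forall i j, free_edge i j -> f1 (gen i j) = f2 (gen i j)) -> f1 =1 f2.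
  move=> eg ee; pose E x := forall hx : x \in H, f1 (Sub x hx) = f2 (Sub x hx).
  have E1 : E 1.
    move=> h1; have -> : Sub 1 h1 = 1 :> G by apply: val_inj; rewrite SubK (hom1 (val : {multiplicative G -> F})).
    by rewrite !hom1.
  have EM x y : x \in H -> y \in H -> E x -> E y -> E (x * y).
    move=> xH yH ex ey xyH.
    have -> : Sub (x * y) xyH = Sub x xH * Sub y yH :> G by apply: val_inj; rewrite valM !SubK.
    by rewrite !gmulfM ex ey.
  have EV x : x \in H -> E x -> E x^-1.
    move=> xH ex xVH.
    have -> : Sub x^-1 xVH = (Sub x xH : G)^-1.
      by apply: val_inj; rewrite (homV (val : {multiplicative G -> F})) !SubK.
    by rewrite !homV ex.
  have Eg : E g by move=> hg; have -> : Sub g hg = g' by apply: val_inj; rewrite !SubK.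
  have Egen i j : E (based_loop u c f i (a j)).
    have [[k [kn ek]]|no] := pselect (exists k, (k < n'.+1)%N /\ edge c n' l0 k = (i, j)); last first.
      move=> h; have -> : Sub (based_loop u c f i (a j)) h = gen i j by apply: val_inj; rewrite !SubK.
      by apply: ee => k kn ek; apply: no; exists k.
    have [ei ej] : i = (edge c n' l0 k).1 /\ j = (edge c n' l0 k).2 by rewrite ek.
    rewrite ei ej; have [lt|ge] := ltnP k n'; first by rewrite gtree.
    have -> : k = n' by apply/eqP; rewrite eqn_leq ge -ltnS kn.
    by rewrite glast; case: (nth _ _ _).2 => //; apply: EV.
  have Eall y : forall i, E (based_loop u c f i y).
    apply: (@free_ind (fun y => forall i, E (based_loop u c f i y))) y.
    - by move=> i; rewrite based_loop1.
    - by move=> x y ex ey i; rewrite based_loopM; apply: EM.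
    - by move=> x ex i; rewrite based_loopV; apply: EV.
    - by move=> j i; exact: Egen.
  move=> x; have xH := valP x; have := xH => /HP/eqP xs.
  have xE : val x = based_loop u c f (vert n' 0) (val x ^ u).
    by rewrite /based_loop xs pre0 mul1g invg1 mulg1 conjgK.
  have := Eall (val x ^ u) (vert n' 0); rewrite -xE => /(_ xH).
  by have -> : Sub (val x) xH = x by apply: val_inj; rewrite SubK.
move=> Q phi.
pose lab i j : Q := if [pick k : 'I_n'.+1 | edge c n' l0 k == (i, j)] is Some k then
    (if (k < n')%N then 1 else if (nth l0 (nf c) n').2 then phi g' else (phi g')^-1)
  else phi (gen i j).
have labE k : (k < n'.+1)%N -> lab (edge c n' l0 k).1 (edge c n' l0 k).2 =
    if (k < n')%N then 1 else if (nth l0 (nf c) n').2 then phi g' else (phi g')^-1.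
  move=> kn; rewrite /lab -surjective_pairing.
  case: pickP => [k' /eqP /(edge_inj cc cn (ltn_ord k') kn) -> //|/(_ (Ordinal kn))].
  by rewrite eqxx.
have [Phi PhiP] := @hom_ext (wreath Q 'I_n'.+1) (fun j => ([ffun i => lab i j], f (a j))).
have tree l1 k : (k < n')%N -> lab (edge c n' l1 k).1 (edge c n' l1 k).2 = 1.
  move=> kn; have -> : edge c n' l1 k = edge c n' l0 k.
    by rewrite /edge (set_nth_default l0) // cn ltnW.
  by rewrite labE ?kn // ltnW.
pose Psi0 (x : G) := (Phi (val x ^ u)).1 (vert n' 0).
have Psi0M : {morph Psi0 : x y / x * y}.
  move=> x y; rewrite /Psi0 valM conjMg (PhiM PhiP).
  by have /HP/eqP -> := valP x.
pose Psi : {multiplicative G -> Q} := HB.pack Psi0 (isMultiplicative.Build G Q Psi0 Psi0M).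
have Psig : Psi g' = phi g'.
  rewrite /Psi /= /Psi0 SubK gE conjgKV (Phi_c cn fP PhiP tree l0) /= labE //.
  by rewrite ltnn; case: (nth _ _ _).2; rewrite ?invgK.
have Psie i j : free_edge i j -> Psi (gen i j) = phi (gen i j).
  move=> fe; rewrite /Psi /= /Psi0 SubK (Phi_based_loop u cn fP PhiP tree) /lab.
  by case: pickP => // k /eqP /fe; rewrite ltn_ord => /(_ isT).
exists Psi; split=> [x [->|[i [j [fe ->]]]]|f' f'P] //; first exact: Psie.
apply: uniq_hom => [|i j fe].
  by rewrite Psig f'P //; left.
by rewrite Psie // f'P //; right; exists i, j.
Qed.

(** * Primitive, simple and non-filling elements *)
(** The map from G to P given by the universal property, followed by the inclusion, is the
    identity on K and on L. *)
Lemma amalgam_generated (G : groupType) (K L : groupClosed G) (P : groupClosed G) (C : {pred G}) :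
  amalgamated_product K L C -> {subset K <= P} -> {subset L <= P} -> forall x, x \in P.
Proof.
move=> [CK CL UP] KP LP x; pose f (y : G) : subgroup P := insubd 1 y.
have fE y : y \in P -> val (f y) = y by move=> yP; rewrite /f val_insubd yP.
have fM (S : groupClosed G) : {subset S <= P} -> hom_on S f.
  move=> SP y z yS zS; apply: val_inj; rewrite valM !fE ?SP //.
  by rewrite gpredM.
have [|||r [rK rL _]] := UP _ f f; [exact: fM|exact: fM|by []|].
have [|||e [_ _ eU]] := UP _ (fun y => y) (fun y => y) => //.
pose e1 : {multiplicative G -> G} := (val : subgroup P -> G) \o r.
pose e2 : {multiplicative G -> G} := idfun.
have E1 : e1 =1 e.
  apply: eU => y yS.
    by have : val (r y) = y by rewrite rK // fE // KP.
  by have : val (r y) = y by rewrite rL // fE // LP.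
have E2 : e2 =1 e by apply: eU.
by rewrite [x](_ : x = val (r x)) ?(valP (r x)) // [LHS](E2 x) -E1.
Qed.

Lemma simple_non_filling (G : groupType) (g : G) : g <> 1 -> simple g -> non_filling g.
Proof.
move=> g1 [K [[L A] KG gK]].
have [|||C CE] := @prop_subgroup G (fun x => x = 1).
- by [].
- by move=> x y -> ->; rewrite mulg1.
- by move=> x ->; rewrite invg1.
have C1 : C =i pred1 1 by move=> x; rewrite inE; apply/idP/eqP => /CE.
exists K, C; split=> //; first by left.
left; exists L; split.
- have [CK CL UP] := A; split.
  + by move=> x; rewrite C1; exact: CK.
  + by move=> x; rewrite C1; exact: CL.
  + move=> Q f f' fM f'M ff'; apply: UP => // x x1; apply: ff'; rewrite C1; exact: x1.
- by move=> CK; apply: g1; apply/CE; rewrite CK.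
move=> CL; apply: KG => x; apply: (amalgam_generated A) => // y.
by rewrite -CL => /CE ->; exact: gpred1.
Qed.

(** G is the free product of the cyclic group generated by g and of the subgroup generated
    by the other elements of the basis. *)
Lemma primitive_simple (G : groupType) (g : G) :
  (exists x y : G, ~ commute x y) -> primitive g -> simple g.
Proof.
move=> [x0 [y0 nc]] [g1 [X Xb Xg]].
have [|||K KE] := @prop_subgroup G (power_of g).
- exact: power_of1.
- by move=> u v; exact: power_ofM.
- by move=> u; exact: power_ofV.
pose span x := forall P : G -> Prop, P 1 -> (forall u v, P u -> P v -> P (u * v)) ->
  (forall u, P u -> P u^-1) -> (forall y, X y -> y <> g -> P y) -> P x.
have [|||L LE] := @prop_subgroup G span.
- by move=> P.
- move=> u v Lu Lv P P1 PM PV PX.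
  exact: (PM _ _ (Lu P P1 PM PV PX) (Lv P P1 PM PV PX)).
- by move=> u Lu P P1 PM PV PX; exact: (PV _ (Lu P P1 PM PV PX)).
have gK : g \in K by apply/KE/power_of_refl.
have XL y : X y -> y <> g -> y \in L by move=> Xy yg; apply/LE => P _ _ _; apply.
exists K; split=> //.
  exists L; split.
  - by move=> x; rewrite inE => /eqP ->; exact: gpred1.
  - by move=> x; rewrite inE => /eqP ->; exact: gpred1.
  move=> Q f f' fM f'M ff'.
  have [e [eX eU]] := Xb Q (fun x => if x == g then f g else f' x).
  have agreeK (r : {multiplicative G -> Q}) : r g = f g -> {in K, r =1 f}.
    move=> rg x /KE [n [->|->]]; first by rewrite homX rg (hom_onX fM).
    by rewrite homV homX rg (hom_onV fM) ?gpredXn // (hom_onX fM).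
  exists e; split.
  - by apply: agreeK; rewrite eX // eqxx.
  - move=> x xL; have /LE xs := xL.
    have [] := xs (fun y => y \in L /\ e y = f' y) => //.
    + by rewrite gpred1 hom1 (hom_on1 f'M).
    + move=> u v [uL eu] [vL ev]; rewrite gpredM //; split=> //.
      by rewrite gmulfM f'M // eu ev.
    + move=> u [uL eu]; rewrite gpredV; split=> //.
      by rewrite homV (hom_onV f'M) // eu.
    + move=> y Xy yg; split; first exact: XL.
      by rewrite eX //; case: eqP.
  move=> r rK rL; apply: eU => x Xx; have [->|/eqP xg] := eqVneq x g.
    exact: rK.
  exact/rL/XL.
move=> KG; apply: nc.
have xK x : power_of g x by apply/KE; rewrite KG.
exact: (power_of_commute (xK x0) (commute_sym (power_of_commute (xK y0) (commute_refl g)))).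
Qed.

Lemma index_nonabelian (H : groupClosed F) d : (2 <= N)%N -> has_index H d ->
  exists x y : subgroup H, ~ commute x y.
Proof.
move=> N2 Hd; pose i0 : 'I_N := Ordinal (ltnW N2); pose i1 : 'I_N := Ordinal N2.
have [k kE] : exists k, d`! = k.+1 by exists d`!.-1; rewrite prednK // fact_gt0.
have aH i : a i ^+ d`! \in H by exact: expg_fact_index Hd (leqnn _).
pose x i : subgroup H := Sub (a i ^+ d`!) (aH i).
exists (x i0), (x i1) => /(congr1 val); rewrite !valM !SubK kE.
move/commute_root/commute_sym/commute_root => e.
have /word_val_inj : word_val a [:: (i1, true); (i0, true)] = word_val a [:: (i0, true); (i1, true)].
  by rewrite !word_val_cons word_val_nil !mulg1.
by move=> /(_ isT isT).
Qed.

(** * The index functions *)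
Lemma nat_infimum (A : set nat) : (exists x, A x) ->
  A (infimum 0%N A) /\ forall x, A x -> (infimum 0%N A <= x)%N.
Proof.
move=> [x0 Ax0].
have exP : exists n, `[< A n >] by exists x0; apply/asboolP.
case: (ex_minnP exP) => m /asboolP Am mmin.
have mm y : A y -> (m <= y)%N by move=> Ay; apply: mmin; apply/asboolP.
suff -> : infimum 0%N A = m by split.
rewrite /infimum; case: ifPn => [/eqP A0|_]; first by rewrite A0 in Ax0.
have h : infimums A m by split=> [y /mm //|y]; apply.
case: xgetP => [y _ [yl yu]|/(_ m) //].
apply/eqP; rewrite eqn_leq; apply/andP; split; first exact: yl.
by apply: yu => z /mm.
Qed.

Lemma nat_supremum (A : set nat) B : (exists x, A x) -> (forall x, A x -> (x <= B)%N) ->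
  A (supremum 0%N A) /\ forall x, A x -> (x <= supremum 0%N A)%N.
Proof.
move=> [x0 Ax0] AB.
have exP : exists n, `[< A n >] by exists x0; apply/asboolP.
have bP n : `[< A n >] -> (n <= B)%N by move=> /asboolP /AB.
case: (ex_maxnP exP bP) => m /asboolP Am mmax.
have mm y : A y -> (y <= m)%N by move=> Ay; apply: mmax; apply/asboolP.
suff -> : supremum 0%N A = m by split.
rewrite /supremum; case: ifPn => [/eqP A0|_]; first by rewrite A0 in Ax0.
have h : supremums A m by split=> [y /mm //|y]; apply.
case: xgetP => [y _ [yu yl]|/(_ m) //].
apply/eqP; rewrite eqn_leq; apply/andP; split; last exact: yu.
by apply: yl => z /mm.
Qed.

(** Without a subgroup in which g satisfies P, min_index P g would be 0 by convention and
    the inequality could fail. *)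
Lemma min_index_mono (P Q : forall H : groupType, H -> Prop) (g : F) :
  (forall (H : groupClosed F) d (h : subgroup H), has_index H d -> h <> 1 -> P _ h -> Q _ h) ->
  g <> 1 ->
  (exists (H : groupClosed F) (gH : g \in H) d, has_index H d /\ P (subgroup H) (Sub g gH)) ->
  (min_index Q g <= min_index P g)%N.
Proof.
move=> PQ g1 [H [gH [d [Hd Pg]]]]; rewrite /min_index.
set A := [set d | _]%classic; set B := [set d | _]%classic.
have [|[H' [gH' [Hi Pi]]] _] := @nat_infimum B; first by exists d, H, gH.
have AB : A (infimum 0%N B).
  exists H', gH'; split=> //; apply: PQ Hi _ Pi.
  by move=> /(congr1 val); rewrite SubK; exact: g1.
by have [_] := @nat_infimum A (ex_intro _ _ AB); apply.
Qed.

Lemma min_index_attained (P : forall H : groupType, H -> Prop) (g : F) :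
  (exists (H : groupClosed F) (gH : g \in H) d, has_index H d /\ P (subgroup H) (Sub g gH)) ->
  exists (H : groupClosed F) (gH : g \in H),
    has_index H (min_index P g) /\ P (subgroup H) (Sub g gH).
Proof.
move=> [H [gH [d [Hd Pg]]]].
have [|h _] := @nat_infimum [set d | exists (H : groupClosed F) (gH : g \in H),
    has_index H d /\ P (subgroup H) (Sub g gH)]%classic; first by exists d, H, gH.
exact: h.
Qed.

Lemma length_bounded (e : F -> nat) n : exists B, forall g, (len g <= n)%N -> (e g <= B)%N.
Proof.
have [|x b|B BP] := @uniform_bound F (ball n) (fun g B => e g <= B)%N.
- by move=> x m k mk /leq_trans; apply.
- by exists (e x).
- by exists B => g gn; apply: BP; rewrite ballP.
Qed.

Lemma max_over_length_mono (e e' : F -> nat) n :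
  (forall g, g <> 1 -> (e g <= e' g)%N) ->
  (max_over_length a e n <= max_over_length a e' n)%N.
Proof.
move=> ee'; rewrite /max_over_length; set S := [set g | _]%classic.
have [[g0 Sg0]|no] := pselect (exists g, S g); last first.
  have -> : S = set0 by apply/seteqP; split=> // g Sg; apply: no; exists g.
  by rewrite !image_set0 /supremum eqxx.
have [B BP] := length_bounded e n; have [B' BP'] := length_bounded e' n.
have [||[g Sg <-] _] := @nat_supremum (e @` S)%classic B.
- by exists (e g0), g0.
- by move=> _ [g [_ _ gn] <-]; exact: BP.
apply: (@leq_trans (e' g)); first by apply: ee'; case: Sg.
have [||_] := @nat_supremum (e' @` S)%classic B'.
- by exists (e' g0), g0.
- by move=> _ [x [_ _ xn] <-]; exact: BP'.
by apply; exists g.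
Qed.

Lemma max_over_length_ge (e : F -> nat) n g :
  g <> 1 -> ~ proper_power g -> (len g <= n)%N -> (e g <= max_over_length a e n)%N.
Proof.
move=> g1 np gn; rewrite /max_over_length; set S := [set g | _]%classic.
have [B BP] := length_bounded e n.
have [||_] := @nat_supremum (e @` S)%classic B.
- by exists (e g), g.
- by move=> _ [x [_ _ xn] <-]; exact: BP.
by apply; exists g.
Qed.

Hypothesis N2 : (2 <= N)%N.

Lemma f_simp_le_prim n : (f_simp a n <= f_prim a n)%N.
Proof.
apply: max_over_length_mono => g g1; apply: min_index_mono => //.
  by move=> H d h Hd _; apply: primitive_simple; exact: index_nonabelian Hd.
exact: primitive_finite_index.
Qed.

Lemma simple_finite_index g : g <> 1 ->
  exists (H : groupClosed F) (gH : g \in H) d, has_index H d /\ simple (Sub g gH : subgroup H).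
Proof.
move=> /primitive_finite_index [H [gH [d [Hd Pg]]]]; exists H, gH, d; split=> //.
by apply: primitive_simple Pg; exact: index_nonabelian Hd.
Qed.

Lemma f_fill_le_simp n : (f_fill a n <= f_simp a n)%N.
Proof.
apply: max_over_length_mono => g g1; apply: min_index_mono => //.
  by move=> H d h Hd; exact: simple_non_filling.
exact: simple_finite_index.
Qed.

Lemma f_fill_gt d n : (0 < d)%N -> (word_bound d <= n)%N -> (d < f_fill a n)%N.
Proof.
move=> d0 dn; have [h [h1 np hl hP]] := controlling_element d0 (ltnW N2).
apply: leq_trans (max_over_length_ge _ h1 np (leq_trans hl dn)).
rewrite ltnNge; apply/negP => le.
have [|H [hH [Hi nf]]] := @min_index_attained (@non_filling) h.
  have [H [hH [e [He Sh]]]] := simple_finite_index h1; exists H, hH, e; split=> //.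
  by apply: simple_non_filling Sh => /(congr1 val); rewrite SubK; exact: h1.
apply: (filling Hi _ _ nf).
  by move=> /(congr1 val); rewrite SubK; exact: h1.
move=> u uH lu; rewrite SubK; apply: (hP H _ Hi le hH u uH).
by rewrite (leq_trans lu) // leq_mul2l le orbT.
Qed.

End FreeGroup.

Lemma fact_le_expn d : (d`! <= d ^ d)%N.
Proof.
elim: d => // d IHd; rewrite factS expnS leq_mul2l /=.
by apply: leq_trans IHd _; case: d => // d; rewrite leq_exp2r.
Qed.

Lemma word_bound_le N d : (0 < d)%N ->
  (word_bound N d <= (10 ^ (N.*2.+1 * 4) * 8 * d) ^ d)%N.
Proof.
move=> d0; rewrite /word_bound (mulnA N.*2.+1) expnM.
move: (10 ^ _)%N => A; rewrite !expnMn -mulnA leq_mul2l.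
apply/orP; right; rewrite mulnC leq_mul ?fact_le_expn //.
have := ltn_expl d (isT : 1 < 2)%N => h.
rewrite (_ : 8 = 4 * 2)%N // expnMn leq_mul ?(ltnW h) //.
by rewrite -{1}[4]expn1 leq_exp2l.
Qed.

(** * Asymptotics *)
Section Asymptotics.
Import Order.TTheory GRing.Theory Num.Theory.
Local Open Scope ring_scope.
Variable R : realType.

Lemma two_mul_le_expR (y : R) : 2 * y <= expR y.
Proof.
have [y0|y0] := ltP y 0.
  by apply: (@le_trans _ _ 0); [rewrite pmulr_rle0 ?ltW|exact: expR_ge0].
have h : 1 + y / 2 <= expR (y / 2) by exact: expR_ge1Dx.
have -> : expR y = expR (y / 2) ^+ 2.
  by rewrite expr2 -expRD; congr expR; lra.
have h0 : 0 <= 1 + y / 2 by lra.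
have : (1 + y / 2) ^+ 2 <= expR (y / 2) ^+ 2 by rewrite lerXn2r ?nnegrE ?expR_ge0.
apply: le_trans; have := sqr_ge0 (1 - y / 2); rewrite !expr2; lra.
Qed.

(** With x = log n and d the integer part of x / (2 log x), both B and d are at most x
    for large n, so (B d)^d <= x^(2 d) <= exp x = n. *)
Lemma log_over_loglog (B : nat) (f : nat -> nat) :
  (forall d n : nat, (0 < d)%N -> ((B * d) ^ d <= n)%N -> (d < f n)%N) ->
  exists M : nat, forall n, (M <= n)%N ->
    2^-1 * (ln n%:R / ln (ln n%:R)) <= (f n)%:R :> R.
Proof.
move=> fB; pose M := (Num.truncn (expR (B%:R + expR 1) : R)).+1; exists M => n Mn.
have nlarge : expR (B%:R + expR 1) <= n%:R :> R.
  apply: (@le_trans _ _ (M%:R)); last by rewrite ler_nat.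
  exact/ltW/truncnS_gt.
have n0 : 0 < n%:R :> R by apply: lt_le_trans nlarge; exact: expR_gt0.
set x := ln n%:R; have nE : n%:R = expR x :> R by rewrite lnK.
have xB : B%:R + expR 1 <= x by rewrite -ler_expR -nE.
have e1 : 1 <= expR 1 :> R by rewrite -[leLHS]expR0 ler_expR.
have B0 : 0 <= B%:R :> R by rewrite ler0n.
have x0 : 0 < x by lra.
set y := ln x; have xE : x = expR y by rewrite lnK.
have y1 : 1 <= y by rewrite -ler_expR -xE; lra.
have y0 : 0 < y by lra.
have xy : 2 * y <= x by rewrite [leRHS]xE; exact: two_mul_le_expR.
set r := 2^-1 * (x / y).
have rE : r * (2 * y) = x by rewrite /r; field; exact: lt0r_neq0.
have r0 : 0 <= r by rewrite /r mulr_ge0 ?divr_ge0 ?invr_ge0 ?ler0n // ltW.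
pose d := Num.truncn r.
have dr : d%:R <= r by rewrite truncn_le.
have rd : r < d.+1%:R by exact: truncnS_gt.
have d0 : (0 < d)%N.
  rewrite truncn_gt0 -(ler_pM2r (_ : 0 < 2 * y)) ?rE ?mul1r //; lra.
apply: le_trans (ltW rd) _; rewrite ler_nat; apply: fB => //.
rewrite -(ler_nat R) natrX natrM nE.
have dx : d%:R <= x by apply: le_trans dr _; rewrite -rE ler_peMr //; lra.
have : B%:R * d%:R <= x ^+ 2 by rewrite expr2 ler_pM ?ler0n //; lra.
move=> Bd; apply: (@le_trans _ _ ((x ^+ 2) ^+ d)).
  by rewrite lerXn2r ?nnegrE ?mulr_ge0 ?ler0n ?exprn_ge0 // ltW.
rewrite -exprM [in leLHS]xE -expRM_natl ler_expR.
have -> : (2 * d)%:R * y = d%:R * (2 * y) by rewrite natrM; ring.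
by rewrite -rE ler_wpM2r //; lra.
Qed.

End Asymptotics.

Theorem theorem1p1 (R : realType) (N : nat) (hN : (2 <= N)%N)
    (F : groupType) (a : 'I_N -> F) (a_inj : injective a)
    (a_basis : free_basis (range a)) :
  exists (c : R) (M : nat),
    [/\ (0 < c)%R, (1 <= M)%N &
      forall n : nat, (M <= n)%N ->
        [/\ (f_simp a n <= f_prim a n)%N,
            (f_fill a n <= f_simp a n)%N &
            (c * (ln n%:R / ln (ln n%:R)) <= (f_fill a n)%:R)%R]].
Proof.
have [|M MP] := @log_over_loglog R (10 ^ (N.*2.+1 * 4) * 8) (f_fill a).
  move=> d n d0 dn; apply: (f_fill_gt a_inj a_basis hN d0).
  exact: leq_trans (word_bound_le N d0) dn.
exists (2^-1)%R, M.+1; split; [by rewrite Num.Theory.invr_gt0 Num.Theory.ltr0n|by []|move=> n Mn; split].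
- exact: f_simp_le_prim.
- exact: f_fill_le_simp.
- by apply: MP; apply: ltnW.
Qed.
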